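(* Let $\varphi:\mathbb R\to\mathbb R$ be a differentiable function such that $\varphi\in L_1(\mathbb R)$, $\varphi(v)\to 0$ as $v\to\pm\infty$, and the derivative $\varphi'$ is bounded on $\mathbb R$. Suppose that every zero $s$ of $\varphi$ is non-degenerate (i.e. $\varphi'(s)\ne 0$), and let $k\in\mathbb R\setminus\{0\}$ be such that every zero $s$ of $\varphi$ satisfies $$1-\frac1{k^2}\int_{-\infty}^{\infty}\frac{\varphi(v)}{v-s}\,dv\ \ne\ 0 .$$ Then the total number $N(k)$ (counted with multiplicity) of roots $\lambda$ of the equation $\Delta(k,\lambda)=0$ in the right half-plane, i.e. $N(k):=\#\{\lambda\in\Lambda(k):\ \mathrm{Re}\,\lambda>0\}$, is given by $$N(k)=N_+(k)-N_-(k),$$ where $$N_+(k)=\#\Big\{s\in\mathbb R:\ \varphi(s)=0,\ \varphi'(s)>0,\ 1-\frac1{k^2}\int_{-\infty}^{\infty}\frac{\varphi(v)}{v-s}\,dv<0\Big\},$$ $$N_-(k)=\#\Big\{s\in\mathbb R:\ \varphi(s)=0,\ \varphi'(s)<0,\ 1-\frac1{k^2}\int_{-\infty}^{\infty}\frac{\varphi(v)}{v-s}\,dv<0\Big\}.$$ For $k=0$ (where it is moreover assumed that $\int_{\mathbb R}(1+|v|)\,|\varphi(v)|\,dv<\infty$), the right half-plane $\{\mathrm{Re}\,\lambda>0\}$ contains at most one root of the equation $\Delta(0,\lambda)=0$, and $\Lambda(0)\cap\{\mathrm{Re}\,\lambda>0\}\ne\varnothing$ if and only if $$\int_{-\infty}^{\infty}v\,\varphi(v)\,dv>0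 .$$
   Context: For $k\in\mathbb R\setminus\{0\}$ and $\lambda\in\mathbb C\setminus i\mathbb R$ put $$\Delta(k,\lambda)=1+\frac1{ik}\int_{-\infty}^{\infty}\frac{\varphi(v)}{ikv+\lambda}\,dv ,$$ and for $k=0$ put $$\Delta(0,\lambda)=1-\frac1{\lambda^2}\int_{-\infty}^{\infty}v\,\varphi(v)\,dv .$$ For $k\in\mathbb R$ let $\Lambda(k)=\{\lambda\in\mathbb C\setminus i\mathbb R:\ \Delta(k,\lambda)=0\}$. The integrals $\int\varphi(v)/(v-s)\,dv$ at zeros $s$ of $\varphi$ converge absolutely. *)

(* Defs.v *)
From HB Require Import structures.
From mathcomp Require Import all_boot all_order all_algebra.
From mathcomp Require Import all_classical all_reals all_analysis.
From mathcomp Require Import complex.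

Set Implicit Arguments.
Unset Strict Implicit.
Unset Printing Implicit Defensive.

Import Order.TTheory GRing.Theory Num.Theory.
Import numFieldNormedType.Exports.

Local Open Scope classical_set_scope.
Local Open Scope ring_scope.
Local Open Scope complex_scope.

(* R[i] packed as a numFieldType: this makes its topology and its structure
   of normed space over itself inferable, so that [derivable f z 1] for
   f : cplx R -> cplx R is complex differentiability at z. *)
Definition cplx (R : realType) : numFieldType := R[i].

Definition cintegral (R : realType) (f : R -> cplx R) : cplx R :=
  (\int[lebesgue_measure]_v complex.Re (f v)) +i* (\int[lebesgue_measure]_v complex.Im (f v)).

Definition Delta (R : realType) (phi : R -> R) (k : R) (l : cplx R) : cplx R :=
  if k == 0 then
    1 - 1 / l ^+ 2 * (\int[lebesgue_measure]_v (v * phi v))%:C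
  else
    1 + 1 / ('i * k%:C) *
        cintegral (fun v => (phi v)%:C / ('i * k%:C * v%:C + l) : cplx R).

Definition Lambda (R : realType) (phi : R -> R) (k : R) : set (cplx R) :=
  [set l | complex.Re l != 0 /\ Delta phi k l = 0].

Definition right_half_plane (R : realType) : set (cplx R) :=
  [set l | 0 < complex.Re l].

(* m is the order of vanishing of f at z: f(w) = (w - z)^m g(w) near z, with g
   holomorphic near z and g(z) <> 0; such an m is unique. *)
Definition zero_order (R : realType) (f : cplx R -> cplx R) (z : cplx R)
    (m : nat) : Prop :=
  exists g : cplx R -> cplx R,
    [/\ \forall w \near z, derivable g w 1,
        g z != 0 &
        \forall w \near z, f w = (w - z) ^+ m * g w].

(* A is finite and the orders of vanishing of f at its points add up to n. *)
Definition count_with_multiplicity (R : realType) (f : cplx R -> cplx R)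
    (A : set (cplx R)) (n : nat) : Prop :=
  exists (s : seq (cplx R)) (m : cplx R -> nat),
    [/\ uniq s,
        A = [set` s],
        forall z, z \in s -> zero_order f z (m z) &
        n = (\sum_(z <- s) m z)%N].

(* At a zero s of phi (the only case of interest) the integrand is bounded near
   s; its value at v = s, where x / 0 = 0, is irrelevant. *)
Definition boundary_value (R : realType) (phi : R -> R) (k s : R) : R :=
  1 - 1 / k ^+ 2 * \int[lebesgue_measure]_v (phi v / (v - s)).

(* Main.v *)
(* Write Delta on the right half-plane as 1 + (ik)^-1 times the Cauchy type integral of
   phi. If m is a zero, then dividing phi by the boundary values of the Blaschke factor of
   m divides Delta by that Blaschke factor. As those boundary values have modulus 1, the
   bounds on the integral are the same for all the functions so obtained, and comparing
   them at one point shows that only finitely many zeros m_1, ..., m_n (with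
   multiplicity) can be divided out. The last quotient has no zero, so that along each
   vertical line its argument has net variation 0, by homotopy to the lines far to the
   right, where it is close to 1. Hence Delta winds n times around 0 along the vertical
   lines close to the imaginary axis. Since phi is Lipschitz, Delta extends continuously
   to that axis, the limit at -ikx having imaginary part -sgn(k) pi phi(x) / k^2 and, at a
   zero x of phi, real part [boundary_value phi k x]. The winding number n is therefore
   the signed number of crossings of the negative real axis, which take place at the
   zeros of phi with negative boundary value, in the direction given by the sign of phi'. *)
Require Import Defs.
From HB Require Import structures.
From mathcomp Require Import all_boot all_order all_algebra.
From mathcomp Require Import all_classical all_reals all_analysis.
From mathcomp Require Import measurable_realfun zify complex ring lra.
Set Implicit Arguments.
Unset Strict Implicit.
Unset Printing Implicit Defensive.
Import Order.TTheory GRing.Theory Num.Theory.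
Import numFieldNormedType.Exports.
Import ComplexField.Normc.
Local Open Scope classical_set_scope.
Local Open Scope card_scope.
Local Open Scope ring_scope.
Local Open Scope complex_scope.
Local Notation Re := (@complex.Re _).
Local Notation Im := (@complex.Im _).

(** * Complex numbers and integrals *)

(** Neither finiteness nor isolation of the roots is known beforehand, so they are divided out one
    at a time, each quotient being searched again for zeros; repeated roots need no separate
    treatment. A division stays within one family of Cauchy type integrals: the resolvent identity
    1/(ikv + l) - 1/(ikv + m) = (m - l)/((ikv + l)(ikv + m)) turns differences, derivatives and
    divisions alike into integrals of phi against bounded kernels. Complex differentiability thereby
    becomes explicit, and it serves only to certify multiplicities. The hypothesis on boundary
    values, with the limit 1 at infinity, keeps the limit curve at a positive distance from 0; by
    uniform convergence the roots then stay away from the imaginary axis, hence in a compact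
    rectangle. Both the orientation of the lines x -> rho - ikx and the imaginary part of the limit
    curve carry the sign of k; a conjugation for k < 0 removes both at once. *)

Section ComplexModulus.
Context {R : realType}.
Implicit Types z w : R[i].

Lemma Re_add z w : Re (z + w) = Re z + Re w.
Proof. by case: z; case: w. Qed.

Lemma Im_add z w : Im (z + w) = Im z + Im w.
Proof. by case: z; case: w. Qed.

Lemma Re_opp z : Re (- z) = - Re z. Proof. by case: z. Qed.

Lemma Im_opp z : Im (- z) = - Im z. Proof. by case: z. Qed.

Lemma Re_mul z w : Re (z * w) = Re z * Re w - Im z * Im w.
Proof. by case: z; case: w. Qed.

Lemma Im_mul z w : Im (z * w) = Re z * Im w + Im z * Re w.
Proof. by case: z; case: w. Qed.

Lemma Re_inv z : Re z^-1 = Re z / (Re z ^+ 2 + Im z ^+ 2).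
Proof. by case: z. Qed.

Lemma Im_inv z : Im z^-1 = - (Im z / (Re z ^+ 2 + Im z ^+ 2)).
Proof. by case: z. Qed.

Lemma complex_ext z w : Re z = Re w -> Im z = Im w -> z = w.
Proof. by case: z => a b; case: w => c d /= -> ->. Qed.

Lemma normc_ge0 z : 0 <= normc z.
Proof. by case: z => a b; rewrite /= sqrtr_ge0. Qed.

Lemma sqr_normc z : normc z ^+ 2 = Re z ^+ 2 + Im z ^+ 2.
Proof. by case: z => a b; rewrite /= sqr_sqrtr// addr_ge0 ?sqr_ge0. Qed.

Lemma normcD z w : normc (z + w) <= normc z + normc w.
Proof. exact: le_normcD. Qed.

Lemma normc_opp z : normc (- z) = normc z.
Proof. exact: normcN. Qed.

Lemma normcB z w : normc (z - w) <= normc z + normc w.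
Proof. by rewrite -(normc_opp w) normcD. Qed.

Lemma normc_subC z w : normc (z - w) = normc (w - z).
Proof. by rewrite -normc_opp opprB. Qed.

Lemma lerB_normc z w : normc z - normc w <= normc (z - w).
Proof. by rewrite lerBlDr (le_trans _ (normcD _ _))// subrK. Qed.

Lemma normc_eq0 z : (normc z == 0) = (z == 0).
Proof.
apply/eqP/eqP => [|->]; first exact: eq0_normc.
exact: normc0.
Qed.

Lemma normc_gt0 z : (0 < normc z) = (z != 0).
Proof. by rewrite lt_def normc_ge0 andbT normc_eq0. Qed.

Lemma normc_real (x : R) : normc x%:C = `|x|.
Proof. by rewrite /= expr0n/= addr0 sqrtr_sqr. Qed.

Lemma normc_i : normc ('i : R[i]) = 1.
Proof. by rewrite /= expr0n/= add0r expr1n sqrtr1. Qed.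

Lemma normc_conj z : normc (conjc z) = normc z.
Proof. by case: z => a b; rewrite /= sqrrN. Qed.

Lemma Re_conj z : Re (conjc z) = Re z. Proof. by case: z. Qed.

Lemma Im_conj z : Im (conjc z) = - Im z. Proof. by case: z. Qed.

Lemma Re_le_normc z : `|Re z| <= normc z.
Proof.
case: z => a b /=; rewrite -sqrtr_sqr ler_sqrt; last by rewrite addr_ge0 ?sqr_ge0.
by rewrite lerDl sqr_ge0.
Qed.

Lemma Im_le_normc z : `|Im z| <= normc z.
Proof.
case: z => a b /=; rewrite -sqrtr_sqr ler_sqrt; last by rewrite addr_ge0 ?sqr_ge0.
by rewrite lerDr sqr_ge0.
Qed.

Lemma normc_le_ReIm z : normc z <= `|Re z| + `|Im z|.
Proof.
rewrite {1}[z]complexE (le_trans (normcD _ _))//.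
by rewrite normcM normc_i mul1r !normc_real.
Qed.

Lemma le_normc_inv z (r : R) : 0 < r -> r <= normc z -> normc z^-1 <= r^-1.
Proof.
move=> r0 rz; rewrite normcV lef_pV2// posrE//; exact: lt_le_trans rz.
Qed.

End ComplexModulus.

Section ComplexIntegral.
Context {R : realType}.
Local Notation mu := (@lebesgue_measure R).
Implicit Types f g : R -> R[i].

Definition cmeasurable f :=
  measurable_fun setT (fun v => Re (f v)) /\
  measurable_fun setT (fun v => Im (f v)).

Definition ccontinuous f :=
  continuous (fun v => Re (f v)) /\ continuous (fun v => Im (f v)).

Definition cintegrable f :=
  mu.-integrable setT (EFin \o (fun v => Re (f v))) /\
  mu.-integrable setT (EFin \o (fun v => Im (f v))).

Definition cint f : R[i] :=
  (\int[mu]_v Re (f v)) +i* (\int[mu]_v Im (f v)).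

(* [powR] vanishes at 0 for a nonzero exponent, in agreement with 0^-1 = 0. *)
Lemma measurable_funV (h : R -> R) :
  measurable_fun setT h -> measurable_fun setT (fun v => (h v)^-1).
Proof.
move=> mh.
have -> : (fun v => (h v)^-1) = (fun v => h v * (h v ^+ 2) `^ (-1)).
  apply/funext => v; rewrite powR_inv1 ?sqr_ge0//.
  have [->|h0] := eqVneq (h v) 0; first by rewrite mul0r invr0.
  by rewrite expr2 invfM mulVKf.
apply: measurable_funM => //.
apply: (measurableT_comp (measurable_powR _)).
exact: measurable_funX.
Qed.

Lemma ccontinuous_cmeasurable f : ccontinuous f -> cmeasurable f.
Proof. by case=> ? ?; split; exact: continuous_measurable_fun. Qed.

Lemma ccontinuous_cst z : ccontinuous (fun=> z).
Proof. by split=> v; exact: cvg_cst. Qed.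

Lemma ccontinuous_real (h : R -> R) : continuous h ->
  ccontinuous (fun v => (h v)%:C).
Proof. by move=> ch; split=> // v; exact: cvg_cst. Qed.

Lemma ccontinuousD f g :
  ccontinuous f -> ccontinuous g -> ccontinuous (fun v => f v + g v).
Proof.
move=> [f1 f2] [g1 g2]; split=> v.
- under eq_fun do rewrite Re_add; exact: (cvgD (f1 v) (g1 v)).
- under eq_fun do rewrite Im_add; exact: (cvgD (f2 v) (g2 v)).
Qed.

Lemma ccontinuousM f g :
  ccontinuous f -> ccontinuous g -> ccontinuous (fun v => f v * g v).
Proof.
move=> [f1 f2] [g1 g2]; split=> v.
- under eq_fun do rewrite Re_mul.
  exact: (cvgB (cvgM (f1 v) (g1 v)) (cvgM (f2 v) (g2 v))).
- under eq_fun do rewrite Im_mul.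
  exact: (cvgD (cvgM (f1 v) (g2 v)) (cvgM (f2 v) (g1 v))).
Qed.

Lemma ccontinuousV f : (forall v, f v != 0) ->
  ccontinuous f -> ccontinuous (fun v => (f v)^-1).
Proof.
move=> f0 [f1 f2].
have n0 v : Re (f v) ^+ 2 + Im (f v) ^+ 2 != 0.
  by rewrite -sqr_normc expf_neq0// normc_eq0.
have cn : continuous (fun v => Re (f v) ^+ 2 + Im (f v) ^+ 2).
  move=> v; under eq_fun do rewrite !expr2.
  exact: (cvgD (cvgM (f1 v) (f1 v)) (cvgM (f2 v) (f2 v))).
have cV : continuous (fun v => (Re (f v) ^+ 2 + Im (f v) ^+ 2)^-1).
  by move=> v; exact: (@continuousV _ _ (fun v => Re (f v) ^+ 2 + Im (f v) ^+ 2) v (n0 v) (cn v)).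
split=> v.
- under eq_fun do rewrite Re_inv.
  exact: (cvgM (f1 v) (cV v)).
- under eq_fun do rewrite Im_inv.
  exact: (cvgN (cvgM (f2 v) (cV v))).
Qed.

Lemma cmeasurableM f g :
  cmeasurable f -> cmeasurable g -> cmeasurable (fun v => f v * g v).
Proof.
move=> [f1 f2] [g1 g2]; split.
- under eq_fun do rewrite Re_mul.
  by apply: measurable_funB; exact: measurable_funM.
- under eq_fun do rewrite Im_mul.
  by apply: measurable_funD; exact: measurable_funM.
Qed.

Lemma cmeasurable_real (h : R -> R) : measurable_fun setT h ->
  cmeasurable (fun v => (h v)%:C).
Proof. by move=> mh; split=> //; exact: measurable_cst. Qed.

Lemma le_cintegrable f (g : R -> R) : cmeasurable f ->
  mu.-integrable setT (EFin \o g) -> (forall v, normc (f v) <= g v) ->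
  cintegrable f.
Proof.
move=> [f1 f2] ig fg; split; apply: le_integrable ig => //.
- exact/measurable_EFinP.
- move=> v _ /=; rewrite lee_fin.
  rewrite (le_trans (Re_le_normc _))// (le_trans (fg v))// ler_norm//.
- exact/measurable_EFinP.
- move=> v _ /=; rewrite lee_fin.
  rewrite (le_trans (Im_le_normc _))// (le_trans (fg v))// ler_norm//.
Qed.

(* The constant 2 is not sharp: real and imaginary parts are bounded separately. *)
Lemma normc_cint_le f (g : R -> R) : cmeasurable f ->
  mu.-integrable setT (EFin \o g) -> (forall v, normc (f v) <= g v) ->
  normc (cint f) <= 2 * \int[mu]_v g v.
Proof.
move=> mf ig fg; have [i1 i2] := le_cintegrable mf ig fg.
apply: (le_trans (normc_le_ReIm _)); rewrite /= mulr2n mulrDl mul1r lerD//.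
- apply: (le_trans (le_normr_Rintegral measurableT i1)); apply: le_Rintegral => //.
  + exact: (integrable_norm i1).
  + by move=> v _; rewrite (le_trans (Re_le_normc _)).
- apply: (le_trans (le_normr_Rintegral measurableT i2)); apply: le_Rintegral => //.
  + exact: (integrable_norm i2).
  + by move=> v _; rewrite (le_trans (Im_le_normc _)).
Qed.

Lemma eq_cint f g : f =1 g -> cint f = cint g.
Proof. by move=> /funext ->. Qed.

Lemma cintD f g : cintegrable f -> cintegrable g ->
  cint (fun v => f v + g v) = cint f + cint g.
Proof.
move=> [f1 f2] [g1 g2]; apply: complex_ext => /=.
- by under eq_Rintegral do rewrite Re_add; exact: RintegralD.
- by under eq_Rintegral do rewrite Im_add; exact: RintegralD.
Qed.

Lemma cintegrableD f g :
  cintegrable f -> cintegrable g -> cintegrable (fun v => f v + g v).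
Proof.
move=> [f1 f2] [g1 g2]; split.
- under eq_fun do rewrite Re_add.
  exact: (integrableD measurableT f1 g1).
- under eq_fun do rewrite Im_add.
  exact: (integrableD measurableT f2 g2).
Qed.

Lemma cintegrableZ z f : cintegrable f -> cintegrable (fun v => z * f v).
Proof.
move=> [f1 f2].
have iZ (c : R) (h : R -> R) : mu.-integrable setT (EFin \o h) ->
    mu.-integrable setT (EFin \o (fun v => c * h v)).
  by move=> /(integrableZl measurableT c).
split.
- under eq_fun do rewrite Re_mul.
  exact: (integrableB measurableT (iZ _ _ f1) (iZ _ _ f2)).
- under eq_fun do rewrite Im_mul.
  exact: (integrableD measurableT (iZ _ _ f2) (iZ _ _ f1)).
Qed.

Lemma cintZ z f : cintegrable f -> cint (fun v => z * f v) = z * cint f.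
Proof.
move=> [f1 f2].
have iZ (c : R) (h : R -> R) : mu.-integrable setT (EFin \o h) ->
    mu.-integrable setT (EFin \o (fun v => c * h v)).
  by move=> /(integrableZl measurableT c).
apply: complex_ext => /=; rewrite ?Re_mul ?Im_mul /=.
- under eq_Rintegral do rewrite Re_mul.
  by rewrite RintegralB ?RintegralZl//; exact: iZ.
- under eq_Rintegral do rewrite Im_mul.
  by rewrite RintegralD ?RintegralZl//; exact: iZ.
Qed.

End ComplexIntegral.

(** * Real integrals: primitives on an interval, tails of integrable functions *)

Section RealIntegrals.
Context {R : realType}.
Local Notation mu := (@lebesgue_measure R).

Lemma Rintegral_indic_itv (a b : R) : a <= b ->
  \int[mu]_v (\1_(`[a, b]%classic) v : R) = b - a.
Proof.
move=> ab; rewrite /Rintegral integral_indic// setIT.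
transitivity (fine (lebesgue_measure [set` `[a, b]])) => //.
rewrite lebesgue_measure_itv/= lte_fin.
case: ltP => [_|ba]; first by rewrite -EFinD.
by rewrite (_ : a = b) ?subrr//; apply/eqP; rewrite eq_le ab ba.
Qed.

Lemma Rintegral_indicM_FTC (f F : R -> R) (a b : R) : a < b ->
  continuous f -> (forall v : R, is_derive v (1 : R) F (f v)) ->
  \int[mu]_v (\1_(`[a, b]%classic) v * f v) = F b - F a.
Proof.
move=> ab cf dF.
have -> : (fun v => \1_(`[a, b]%classic) v * f v) = f \_ `[a, b].
  apply/funext => v; rewrite patchE indicE.
  by case: ifP => _; rewrite ?mul1r ?mul0r.
have cF : continuous F.
  by move=> v; apply/differentiable_continuous/derivable1_diffP; case: (dF v).
rewrite -Rintegral_mkcond /Rintegral (@continuous_FTC2 _ f F)//.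
- exact: continuous_subspaceT.
- split.
  + by move=> v _; case: (dF v).
  + exact/cvg_at_right_filter/cF.
  + exact/cvg_at_left_filter/cF.
- by move=> v _; rewrite derive1E; case: (dF v).
Qed.

(** For fixed v the truncations vanish as soon as n >= |v|, so dominated convergence with bound
    |phi| sends their integrals to 0. *)
Lemma tail_integral_small (phi : R -> R) (eta : R) :
  mu.-integrable setT (EFin \o phi) -> 0 < eta ->
  exists2 n : nat, mu.-integrable setT
      (EFin \o (fun v => if n%:R < `|v| then `|phi v| else 0)) &
    \int[mu]_v (if n%:R < `|v| then `|phi v| else 0) < eta.
Proof.
move=> iphi eta0.
pose f n v := if n%:R < `|v| then `|phi v| else 0.
have mphi : measurable_fun setT phi.
  by apply/measurable_EFinP; exact: measurable_int iphi.
have mf n : measurable_fun setT (f n).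
  apply: measurable_fun_ifT; last exact: measurable_cst.
    by apply: measurable_fun_ltr; [exact: measurable_cst | exact: normr_measurable].
  exact: measurableT_comp.
have iphin := integrable_norm iphi.
have f_le n v : `|f n v| <= `|phi v|.
  by rewrite /f; case: ifP => _; rewrite ?normr_id ?normr0.
have if_ n : mu.-integrable setT (EFin \o f n).
  apply: le_integrable iphin => //; first by apply/measurable_EFinP; exact: mf.
  by move=> v _ /=; rewrite lee_fin normr_id.
have [] := @dominated_convergence _ _ _ mu setT measurableT
    (fun n => EFin \o f n) (cst 0%E) (EFin \o (fun v => `|phi v|)).
- by move=> n; apply/measurable_EFinP; exact: mf.
- exact: measurable_cst.
- apply/aeW => v _; apply: cvg_near_cst; near=> n.
  rewrite /= /f ltNge [_ <= _](_ : _ = true)//; near: n.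
  exact: nbhs_infty_ger.
- exact: iphin.
- by apply/aeW => v n _ /=; rewrite lee_fin.
move=> _ _; rewrite integral0 => /fine_cvgP [_] /cvgrPdist_lt /(_ _ eta0) [n _ /(_ n (leqnn _))].
rewrite /= sub0r normrN => fn.
exists n; first exact: if_.
exact: le_lt_trans (ler_norm _) fn.
Unshelve. all: end_near. Qed.

Lemma is_derive_affine (c x v : R) : is_derive v (1 : R) (fun v : R => c * (v - x)) c.
Proof.
have d : is_derive v (1:R) _ _ :=
  is_deriveZ c (is_deriveB (is_derive_id v (1:R)) (is_derive_cst x v (1:R))).
rewrite subr0 [c *: _]mulr1 in d. exact: d.
Qed.
Lemma is_derive_atan_affine (c x v : R) :
  is_derive v (1 : R) (fun v : R => atan (c * (v - x))) (c / (1 + (c * (v - x)) ^+ 2)).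
Proof.
rewrite mulrC; exact: (is_derive1_comp (is_derive1_atan _) (is_derive_affine c x v)).
Qed.
Lemma is_derive_ln_quadratic (r c x v : R) : 0 < r ->
  is_derive v (1 : R) (fun v : R => ln (r + (c * (v - x)) ^+ 2))
   (2 * c * (c * (v - x)) / (r + (c * (v - x)) ^+ 2)).
Proof.
move=> r0.
have n0 : 0 < r + (c * (v - x)) ^+ 2 by rewrite ltr_pwDl// sqr_ge0.
have d : is_derive v (1:R) _ _ :=
  is_deriveD (is_derive_cst r v (1:R)) (is_deriveX 2 (is_derive_affine c x v)).
have e := @is_derive1_comp R (@ln R) (fun v => r + (c * (v - x)) ^+ 2) v _ _
  (is_derive1_ln n0) d.
have -> : 2 * c * (c * (v - x)) / (r + (c * (v - x)) ^+ 2) =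
    (r + (c * (v - x)) ^+ 2)^-1 * (0 + (2%:R * (c * (v - x)) ^+ 2.-1) *: c).
  by rewrite add0r /= expr1 /GRing.scale /=; ring.
exact: e.
Qed.

End RealIntegrals.

(** * Division by Blaschke factors *)

Section BlaschkeChain.
Context {R : realType} (phi : R -> R) (k : R).
Hypotheses (phi_cont : continuous phi)
  (phi_int : (@lebesgue_measure R).-integrable setT (EFin \o phi)) (k0 : k != 0).
Local Notation mu := (@lebesgue_measure R).
Implicit Types (l m : R[i]) (t : seq R[i]).

(** The denominator in [Delta]. Its real part is Re l for every v, which bounds its inverse by 1 /
    Re l. *)
Definition kern l (v : R) : R[i] := 'i * k%:C * v%:C + l.

(** At l = -ikv, the point where [kern l v] vanishes, the Blaschke factor (l - m) / (l + conjc m)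
    takes the value [kern m v / (kern 0 v - conjc m)]; the inverses of these values are multiplied
    here. *)
Definition blaschke t (v : R) : R[i] :=
  \prod_(m <- t) ((kern 0 v - conjc m) / kern m v).

(* [deflated [::]] is [Delta]; the factor [blaschke t], of modulus 1 on the real
   line, divides out the zeros listed in t, see [deflated_chain]. *)
Definition deflated t l : R[i] :=
  1 + 1 / ('i * k%:C) * cint (fun v => (phi v)%:C * (blaschke t v / kern l v)).

Definition L1norm : R := \int[mu]_v `|phi v|.

Lemma L1norm_ge0 : 0 <= L1norm.
Proof. by apply: Rintegral_ge0 => v _. Qed.

Lemma Re_kern l v : Re (kern l v) = Re l.
Proof. by case: l => a b /=; rewrite !(mul0r, mulr0, mul1r, subr0, add0r, addr0, sub0r, oppr0). Qed.

Lemma Im_kern l v : Im (kern l v) = k * v + Im l.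
Proof. by case: l => a b /=; rewrite !(mul0r, mulr0, mul1r, subr0, add0r, addr0). Qed.

Lemma kern_neq0 l v : 0 < Re l -> kern l v != 0.
Proof.
move=> l0; apply/eqP => /(congr1 Re); rewrite Re_kern /= => l00.
by rewrite l00 ltxx in l0.
Qed.

Lemma Re_le_kern l v : Re l <= normc (kern l v).
Proof. by rewrite -{1}(Re_kern l v) (le_trans (ler_norm _))// Re_le_normc. Qed.

Lemma Im_le_kern l v : `|k * v + Im l| <= normc (kern l v).
Proof. by rewrite -Im_kern Im_le_normc. Qed.

Lemma ik_neq0 : 'i * k%:C != 0 :> R[i].
Proof. by rewrite -normc_eq0 normcM normc_i mul1r normc_real normr_eq0. Qed.

Lemma normc_ik : normc ('i * k%:C) = `|k|.
Proof. by rewrite normcM normc_i mul1r normc_real. Qed.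

Lemma ccontinuous_kern l : ccontinuous (kern l).
Proof.
apply: ccontinuousD; last exact: ccontinuous_cst.
apply: ccontinuousM; first exact: ccontinuous_cst.
by apply: ccontinuous_real => v; exact: cvg_id.
Qed.

Lemma ccontinuous_kernV l : 0 < Re l -> ccontinuous (fun v => (kern l v)^-1).
Proof.
move=> l0; apply: ccontinuousV; last exact: ccontinuous_kern.
by move=> v; exact: kern_neq0.
Qed.

Lemma normc_kernV l v : 0 < Re l -> normc (kern l v)^-1 <= (Re l)^-1.
Proof. by move=> l0; apply: le_normc_inv => //; exact: Re_le_kern. Qed.

Lemma ccontinuous_blaschke t : {in t, forall m, 0 < Re m} ->
  ccontinuous (blaschke t).
Proof.
rewrite /blaschke; elim: t => [_|m t ih mt].
  by under eq_fun do rewrite big_nil; exact: ccontinuous_cst.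
under eq_fun do rewrite big_cons.
apply: ccontinuousM; last first.
  by apply: ih => m' m't; apply: mt; rewrite inE m't orbT.
apply: ccontinuousM; last by apply: ccontinuous_kernV; apply: mt; rewrite mem_head.
by apply: ccontinuousD; [exact: ccontinuous_kern | exact: ccontinuous_cst].
Qed.

Lemma normc_blaschke t v : {in t, forall m, 0 < Re m} ->
  normc (blaschke t v) = 1.
Proof.
rewrite /blaschke; elim: t => [_|m t ih mt]; first by rewrite big_nil normc1.
rewrite big_cons normcM ih ?mulr1; last first.
  by move=> m' m't; apply: mt; rewrite inE m't orbT.
have m0 : 0 < Re m by apply: mt; rewrite mem_head.
rewrite normcM normcV.
have -> : kern 0 v - conjc m = - conjc (kern m v).
  by apply: complex_ext; rewrite ?(Re_add, Re_opp, Re_conj, Re_kern)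
    ?(Im_add, Im_opp, Im_conj, Im_kern) /=; ring.
by rewrite normc_opp normc_conj divff// normc_eq0 kern_neq0.
Qed.

Lemma cintegrable_phi (q : R -> R[i]) B : ccontinuous q ->
  (forall v, normc (q v) <= B) -> cintegrable (fun v => (phi v)%:C * q v).
Proof.
move=> cq qB; apply: (@le_cintegrable _ _ (fun v => B * `|phi v|)).
- by apply: ccontinuous_cmeasurable; apply: ccontinuousM => //; exact: ccontinuous_real.
- exact: (integrableZl measurableT B (integrable_norm phi_int)).
- by move=> v; rewrite normcM normc_real mulrC ler_wpM2r.
Qed.

Lemma normc_cint_phi (q : R -> R[i]) B : ccontinuous q ->
  (forall v, normc (q v) <= B) ->
  normc (cint (fun v => (phi v)%:C * q v)) <= 2 * (B * L1norm).
Proof.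
move=> cq qB; rewrite /L1norm -RintegralZl//; last exact: integrable_norm.
apply: normc_cint_le.
- by apply: ccontinuous_cmeasurable; apply: ccontinuousM => //; exact: ccontinuous_real.
- exact: (integrableZl measurableT B (integrable_norm phi_int)).
- by move=> v; rewrite normcM normc_real mulrC ler_wpM2r.
Qed.

Section FixedChain.
Variable t : seq R[i].
Hypothesis t_gt0 : {in t, forall m, 0 < Re m}.

Lemma ccontinuous_blaschke1 l : 0 < Re l ->
  ccontinuous (fun v => blaschke t v / kern l v).
Proof.
move=> l0; apply: ccontinuousM; first exact: ccontinuous_blaschke.
exact: ccontinuous_kernV.
Qed.

Lemma ccontinuous_blaschke2 l m : 0 < Re l -> 0 < Re m ->
  ccontinuous (fun v => blaschke t v / kern l v / kern m v).
Proof.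
move=> l0 m0; apply: ccontinuousM; first exact: ccontinuous_blaschke1.
exact: ccontinuous_kernV.
Qed.

Lemma normc_blaschke1 l v (e : R) : 0 < e -> e <= Re l ->
  normc (blaschke t v / kern l v) <= e^-1.
Proof.
move=> e0 el; rewrite normcM normc_blaschke// mul1r.
by apply: le_normc_inv => //; apply: le_trans (Re_le_kern _ _).
Qed.

Lemma normc_blaschke2 l m v (e : R) : 0 < e -> e <= Re l -> e <= Re m ->
  normc (blaschke t v / kern l v / kern m v) <= e^-1 * e^-1.
Proof.
move=> e0 el em; rewrite normcM ler_pM ?normc_ge0//; first exact: normc_blaschke1.
by apply: le_normc_inv => //; apply: le_trans (Re_le_kern _ _).
Qed.

Lemma cintegrable_blaschke1 l : 0 < Re l ->
  cintegrable (fun v => (phi v)%:C * (blaschke t v / kern l v)).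
Proof.
move=> l0; apply: (@cintegrable_phi _ (Re l)^-1); first exact: ccontinuous_blaschke1.
by move=> v; exact: normc_blaschke1.
Qed.

Lemma cintegrable_blaschke2 l m : 0 < Re l -> 0 < Re m ->
  cintegrable (fun v => (phi v)%:C * (blaschke t v / kern l v / kern m v)).
Proof.
move=> l0 m0; pose e := Num.min (Re l) (Re m).
have e0 : 0 < e by rewrite lt_min l0.
apply: (@cintegrable_phi _ (e^-1 * e^-1)); first exact: ccontinuous_blaschke2.
by move=> v; apply: normc_blaschke2; rewrite // ge_min lexx ?orbT.
Qed.

(** Up to sign the divided difference of [deflated t], and at the same time the correction caused by
    one more Blaschke factor. This double role makes the division possible. *)
Definition deflated_slope l m : R[i] :=
  1 / ('i * k%:C) *
    cint (fun v => (phi v)%:C * (blaschke t v / kern l v / kern m v)).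

Lemma deflatedB l m : 0 < Re l -> 0 < Re m ->
  deflated t l - deflated t m = (m - l) * deflated_slope l m.
Proof.
move=> l0 m0; rewrite /deflated /deflated_slope.
have i1 := cintegrable_blaschke1 m0.
have i2 := cintegrable_blaschke2 l0 m0.
have -> : cint (fun v => (phi v)%:C * (blaschke t v / kern l v)) =
   cint (fun v => (phi v)%:C * (blaschke t v / kern m v)) +
   (m - l) * cint (fun v => (phi v)%:C * (blaschke t v / kern l v / kern m v)).
  rewrite -cintZ// -cintD//; last exact: cintegrableZ.
  apply: eq_cint => v.
  have := kern_neq0 v l0; have := kern_neq0 v m0.
  have -> : m - l = kern m v - kern l v by rewrite /kern; ring.
  by move=> ? ?; field; apply/andP; split.
by ring.
Qed.

Lemma normc_deflated_slope l m (e : R) : 0 < e -> e <= Re l -> e <= Re m ->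
  normc (deflated_slope l m) <= 2 * (e^-1 * e^-1 * L1norm) / `|k|.
Proof.
move=> e0 el em; rewrite /deflated_slope normcM mul1r normcV normc_ik mulrC.
rewrite ler_wpM2r ?invr_ge0// normc_cint_phi//.
  by apply: ccontinuous_blaschke2; exact: lt_le_trans e0 _.
by move=> v; exact: normc_blaschke2.
Qed.

Lemma deflated_lipschitz l m (e : R) : 0 < e -> e <= Re l -> e <= Re m ->
  normc (deflated t l - deflated t m) <=
    2 * (e^-1 * e^-1 * L1norm) / `|k| * normc (l - m).
Proof.
move=> e0 el em; rewrite deflatedB ?(lt_le_trans e0)// normcM normc_subC mulrC.
by rewrite ler_wpM2r ?normc_ge0// normc_deflated_slope.
Qed.

Lemma deflated_near1 l (e : R) : 0 < e -> e <= Re l ->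
  normc (deflated t l - 1) <= 2 * (e^-1 * L1norm) / `|k|.
Proof.
move=> e0 el; rewrite /deflated addrC addKr normcM mul1r normcV normc_ik mulrC.
rewrite ler_wpM2r ?invr_ge0// normc_cint_phi//.
  by apply: ccontinuous_blaschke1; exact: lt_le_trans e0 _.
by move=> v; exact: normc_blaschke1.
Qed.

(** The additional factor is 1 - (m + conjc m) / [kern m v], because [kern 0 v - conjc m] =
    [kern m v] - (m + conjc m). *)
Lemma deflated_cons_slope l m : 0 < Re l -> 0 < Re m ->
  deflated (m :: t) l = deflated t l - (m + conjc m) * deflated_slope l m.
Proof.
move=> l0 m0; rewrite /deflated /deflated_slope.
have i1 := cintegrable_blaschke1 l0.
have i2 := cintegrable_blaschke2 l0 m0.
have -> : cint (fun v => (phi v)%:C * (blaschke (m :: t) v / kern l v)) =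
   cint (fun v => (phi v)%:C * (blaschke t v / kern l v)) +
   - (m + conjc m) *
     cint (fun v => (phi v)%:C * (blaschke t v / kern l v / kern m v)).
  rewrite -cintZ// -cintD//; last exact: cintegrableZ.
  apply: eq_cint => v; rewrite /blaschke big_cons -/(blaschke t v).
  have := kern_neq0 v l0; have := kern_neq0 v m0.
  have -> : kern 0 v - conjc m = kern m v - (m + conjc m) by rewrite /kern; ring.
  by move=> ? ?; field; apply/andP; split.
by ring.
Qed.

(** When [deflated t] vanishes at m, its value at l is (m - l) times the slope, so the slope can be
    eliminated: (l - m) + (m + conjc m) = l + conjc m. The product form remains meaningful at l =
    m. *)
Lemma deflated_cons l m : 0 < Re l -> 0 < Re m -> deflated t m = 0 ->
  deflated (m :: t) l * (l - m) = deflated t l * (l + conjc m).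
Proof.
move=> l0 m0 tm0; have tl := deflatedB l0 m0; rewrite tm0 subr0 in tl.
by rewrite deflated_cons_slope// tl; ring.
Qed.

End FixedChain.

(* A zero of order n occurs n times in a maximal chain. *)
Fixpoint zero_chain t : Prop :=
  if t is m :: t' then [/\ 0 < Re m, deflated t' m = 0 & zero_chain t'] else True.

Lemma zero_chain_gt0 t : zero_chain t -> {in t, forall m, 0 < Re m}.
Proof.
elim: t => [//|m t ih] /= [m0 _ ct] m'; rewrite inE => /predU1P[->//|].
exact: ih.
Qed.

Lemma deflated_chain t l : zero_chain t -> 0 < Re l ->
  deflated t l * \prod_(m <- t) (l - m) =
  deflated [::] l * \prod_(m <- t) (l + conjc m).
Proof.
move=> + l0; elim: t => [_|m t ih /= [m0 tm0 ct]]; first by rewrite !big_nil.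
rewrite !big_cons mulrA deflated_cons//; last exact: zero_chain_gt0.
by rewrite -mulrA mulrCA ih// mulrCA mulrA.
Qed.

(** A member of a chain is by definition a zero of a later quotient only. In [deflated_chain] at l =
    m the left side vanishes, while the factors m + conjc w on the right have positive real part. *)
Lemma zero_chain_root t m : zero_chain t -> m \in t -> deflated [::] m = 0.
Proof.
move=> ct mt; have m0 := zero_chain_gt0 ct mt.
have /eqP := deflated_chain ct m0.
rewrite (big_rem m mt) /= subrr mul0r mulr0 eq_sym mulf_eq0 => /orP[/eqP//|].
rewrite prodf_seq_eq0 => /hasP[w wt]; rewrite andTb => /eqP /(congr1 Re).
rewrite Re_add Re_conj /= => mw0.
by have := addr_gt0 m0 (zero_chain_gt0 ct wt); rewrite mw0 ltxx.
Qed.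

End BlaschkeChain.

(** * Decay of the quotients minus 1 for large imaginary part *)

Section Tail.
Context {R : realType} (phi : R -> R) (k : R).
Hypotheses (phi_cont : continuous phi)
  (phi_int : (@lebesgue_measure R).-integrable setT (EFin \o phi)) (k0 : k != 0).
Local Notation mu := (@lebesgue_measure R).

Lemma deflated_tail (t : seq R[i]) (e eta : R) : {in t, forall m, 0 < Re m} ->
  0 < e -> 0 < eta ->
  exists2 X : R, 0 < X & forall l, e <= Re l -> X <= `|Im l| ->
    normc (deflated phi k t l - 1) <= eta.
Proof.
move=> t0 e0 eta0.
have nk0 : 0 < `|k| by rewrite normr_gt0.
(* The integral is split at |v| = n. Two pieces of size d, the factor 2 of [normc_cint_le] and the
   prefactor 1/|k| give eta. *)
pose d := `|k| * eta / 4.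
have d0 : 0 < d by rewrite divr_gt0// mulr_gt0.
have [n ifn fn] := tail_integral_small phi_int (mulr_gt0 d0 e0).
set f := fun v => _ in ifn; rewrite -/(f _) in fn.
pose N := L1norm phi.
have N0 : 0 <= N by exact: L1norm_ge0.
(* For |v| <= n the kernel has modulus at least |Im l| - |k| n >= Y, and N / Y <= d; the 1 keeps Y
   positive when N = 0. *)
pose Y := (N + 1) / d.
have Y0 : 0 < Y by rewrite divr_gt0// ltr_wpDl.
exists (`|k| * n%:R + Y); first by rewrite ltr_wpDl// mulr_ge0.
move=> l el Xl.
have l0 : 0 < Re l by exact: lt_le_trans el.
rewrite /deflated addrC addKr normcM mul1r normcV normc_ik.
pose g v := e^-1 * f v + Y^-1 * `|phi v|.
have i1 : mu.-integrable setT (EFin \o (fun v => e^-1 * f v)).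
  exact: (integrableZl measurableT _ ifn).
have i2 : mu.-integrable setT (EFin \o (fun v => Y^-1 * `|phi v|)).
  exact: (integrableZl measurableT _ (integrable_norm phi_int)).
have ig : mu.-integrable setT (EFin \o g) by exact: (integrableD measurableT i1 i2).
have gE : \int[mu]_v g v = e^-1 * (\int[mu]_v f v) + Y^-1 * N.
  by rewrite RintegralD// !RintegralZl//; exact: integrable_norm.
have le_g v : normc ((phi v)%:C * (blaschke k t v / kern k l v)) <= g v.
  rewrite normcM normc_real normcM normc_blaschke// mul1r /g /f.
  case: ifPn => [_|]; last first.
    rewrite -leNgt mulr0 add0r => vn; rewrite mulrC ler_wpM2r//.
    apply: le_normc_inv => //; apply: le_trans (Im_le_kern _ _ _).
    have /= kvn : `|k * v| <= `|k| * n%:R by rewrite normrM ler_wpM2l.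
    have := ler_normD (k * v + Im l) (- (k * v)).
    by rewrite addrAC subrr add0r normrN; lra.
  rewrite mulrC ler_wpDr ?mulr_ge0 ?invr_ge0 ?(ltW Y0)// ler_wpM2r//.
  by apply: le_normc_inv => //; apply: le_trans (Re_le_kern _ _ _).
have mF : cmeasurable (fun v => (phi v)%:C * (blaschke k t v / kern k l v)).
  apply: ccontinuous_cmeasurable; apply: ccontinuousM; first exact: ccontinuous_real.
  exact: ccontinuous_blaschke1.
have := normc_cint_le mF ig le_g.
rewrite gE => cF; rewrite mulrC ler_pdivrMr//.
apply: (le_trans cF).
have h1 : e^-1 * (\int[mu]_v f v) <= d.
  by rewrite mulrC ler_pdivrMr// ltW.
have h2 : Y^-1 * N <= d.
  by rewrite mulrC ler_pdivrMr// /Y mulrC divfK ?gt_eqF//; lra.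
by rewrite /d in h1 h2; lra.
Qed.

End Tail.

(** * Boundary values on the imaginary axis *)

Section BoundaryValues.
Context {R : realType} (phi : R -> R) (k M B : R).
Hypotheses (phi_cont : continuous phi)
  (phi_int : (@lebesgue_measure R).-integrable setT (EFin \o phi)) (k0 : k != 0)
  (phi_lip : forall x y, `|phi x - phi y| <= M * `|x - y|)
  (phi_bnd : forall x, `|phi x| <= B).
Local Notation mu := (@lebesgue_measure R).

Definition centered_indic (r x v : R) : R := \1_(`[x - r, x + r]%classic) v.

Local Notation window := (centered_indic 1).

(* The limit of [Delta phi k (rho - ikx)] as rho tends to 0+. Subtracting phi x on
   [x - 1, x + 1] replaces the principal value, the kernel 1/(v - x) being odd. *)
Definition boundary_curve (x : R) : R[i] :=
  (1 - 1 / k ^+ 2 * \int[mu]_v ((phi v - window x v * phi x) / (v - x))) +i*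
  (- (Num.sg k * pi * phi x / k ^+ 2)).

(** The ordinate -kx places the near-singularity of the kernel at v = x: it becomes rho + ik(v - x).
    The line is run through downwards when k > 0. *)
Definition vline (rho x : R) : R[i] := rho +i* (- (k * x)).

Lemma centered_indicE (r x v : R) : centered_indic r x v = (`|v - x| <= r)%R%:R.
Proof.
rewrite /centered_indic indicE; congr ((nat_of_bool _)%:R).
apply/idP/idP; rewrite ?inE /= ?in_itv /= ler_norml => /andP[? ?];
  apply/andP; split; lra.
Qed.

Lemma integrable_centered_indic (r x : R) :
  mu.-integrable setT (EFin \o centered_indic r x).
Proof. exact: integrable_indic_itv. Qed.

Lemma Rintegral_centered_indic (r x : R) : 0 <= r ->
  \int[mu]_v centered_indic r x v = 2 * r.
Proof. by move=> r0; rewrite /centered_indic Rintegral_indic_itv; [ring|lra]. Qed.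

Lemma kern_vline rho x v : kern k (vline rho x) v = rho +i* (k * (v - x)).
Proof. by apply: complex_ext; rewrite ?Re_kern// Im_kern /=; ring. Qed.

(** The real part of the inverse kernel is a Poisson kernel, with primitive an arctangent; the
    imaginary part is odd about x and cancels on the symmetric window. The limit pi / |k| for rho ->
    0 produces the imaginary part of [boundary_curve]. *)
Lemma window_kern_cint (rho x : R) : 0 < rho ->
  cint (fun v => (window x v)%:C * (kern k (vline rho x) v)^-1) =
  (2 / k * atan (k / rho))%:C.
Proof.
move=> rho0.
have xx : x - 1 < x + 1 by lra.
have n0 v : 0 < rho ^+ 2 + (k * (v - x)) ^+ 2.
  by rewrite ltr_pwDl ?exprn_gt0// sqr_ge0.
have cn : continuous (fun v => rho ^+ 2 + (k * (v - x)) ^+ 2).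
  have ch : continuous (fun v => k * (v - x)).
    move=> v; apply: cvgM; first exact: cvg_cst.
    by apply: cvgB; [exact: cvg_id | exact: cvg_cst].
  by move=> v; apply: cvgD; [exact: cvg_cst | exact: (cvgM (ch v) (ch v))].
have cV : continuous (fun v => (rho ^+ 2 + (k * (v - x)) ^+ 2)^-1).
  move=> v; apply: (@continuousV _ _ (fun v => rho ^+ 2 + (k * (v - x)) ^+ 2) v _ (cn v)).
  by rewrite gt_eqF.
have -> : (fun v => (window x v)%:C * (kern k (vline rho x) v)^-1) =
    (fun v => (window x v * (rho * (rho ^+ 2 + (k * (v - x)) ^+ 2)^-1)) +i*
        (window x v * (- (k * (v - x) * (rho ^+ 2 + (k * (v - x)) ^+ 2)^-1)))).
  by apply/funext => v; rewrite kern_vline; apply: complex_ext => /=; ring.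
apply: complex_ext => /=.
- have dF v : is_derive v (1 : R) (fun v => k^-1 * atan (k / rho * (v - x)))
      (rho * (rho ^+ 2 + (k * (v - x)) ^+ 2)^-1).
    have d := is_deriveZ k^-1 (is_derive_atan_affine (k / rho) x v).
    have -> : rho * (rho ^+ 2 + (k * (v - x)) ^+ 2)^-1 =
        k^-1 *: (k / rho / (1 + (k / rho * (v - x)) ^+ 2)).
      have -> : 1 + (k / rho * (v - x)) ^+ 2 = (rho ^+ 2 + (k * (v - x)) ^+ 2) / rho ^+ 2.
        by field; rewrite gt_eqF.
      by rewrite /GRing.scale /=; field; rewrite ?k0 !gt_eqF.
    exact: d.
  have cF : continuous (fun v => rho * (rho ^+ 2 + (k * (v - x)) ^+ 2)^-1).
    by move=> v; apply: cvgM; [exact: cvg_cst|exact: cV].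
  rewrite /centered_indic (Rintegral_indicM_FTC xx cF dF).
  have -> : k / rho * (x + 1 - x) = k / rho by ring.
  have -> : k / rho * (x - 1 - x) = - (k / rho) by ring.
  by rewrite atanN; field.
- have dF v : is_derive v (1 : R)
      (fun v => - (2 * k)^-1 * ln (rho ^+ 2 + (k * (v - x)) ^+ 2))
      (- (k * (v - x) * (rho ^+ 2 + (k * (v - x)) ^+ 2)^-1)).
    have d := is_deriveZ (- (2 * k)^-1) (is_derive_ln_quadratic k x v (exprn_gt0 2 rho0)).
    have -> : - (k * (v - x) * (rho ^+ 2 + (k * (v - x)) ^+ 2)^-1) =
       - (2 * k)^-1 *: (2 * k * (k * (v - x)) / (rho ^+ 2 + (k * (v - x)) ^+ 2)).
      by rewrite /GRing.scale /=; field; rewrite ?k0 !gt_eqF.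
    exact: d.
  have cF : continuous (fun v => - (k * (v - x) * (rho ^+ 2 + (k * (v - x)) ^+ 2)^-1)).
    move=> v; apply: cvgN; apply: cvgM; last exact: cV.
    apply: cvgM; first exact: cvg_cst.
    by apply: cvgB; [exact: cvg_id | exact: cvg_cst].
  rewrite /centered_indic (Rintegral_indicM_FTC xx cF dF).
  have -> : k * (x + 1 - x) = k by ring.
  have -> : k * (x - 1 - x) = - k by ring.
  by rewrite sqrrN subrr.
Qed.

Lemma phi_B_ge0 : 0 <= B.
Proof. exact: le_trans (phi_bnd 0). Qed.

Lemma lip_ge0 : 0 <= M.
Proof. by have := phi_lip 1 0; rewrite subr0 normr1 mulr1; exact: le_trans. Qed.

Definition local_part (x v : R) : R := phi v - window x v * phi x.

Lemma measurable_local_part x : measurable_fun setT (local_part x).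
Proof.
apply: measurable_funB; first exact: continuous_measurable_fun.
apply: measurable_funM; last exact: measurable_cst.
exact: measurable_indic.
Qed.

(** Within the window the Lipschitz bound absorbs the denominator; outside it |v - x| > 1 and the
    division only decreases |phi v|. *)
Lemma local_part_slope_le x v :
  `|local_part x v| * `|v - x|^-1 <= `|phi v| + M * window x v.
Proof.
rewrite /local_part centered_indicE; case: (leP `|v - x| 1) => vx; last first.
  rewrite mulr0n mul0r subr0 mulr0 addr0 -[leRHS]mulr1 ler_wpM2l//.
  by rewrite invf_le1 ?ltW// (lt_trans _ vx).
rewrite mulr1n mul1r mulr1.
have [->|vx0] := eqVneq v x; first by rewrite subrr normr0 mul0r addr_ge0// lip_ge0.
rewrite ler_wpDl// ler_pdivrMr ?normr_gt0 ?subr_eq0//.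
Qed.

Lemma integrable_local_slope x :
  mu.-integrable setT (EFin \o (fun v => local_part x v / (v - x))).
Proof.
have mg : measurable_fun setT (fun v => local_part x v / (v - x)).
  apply: measurable_funM; first exact: measurable_local_part.
  apply: measurable_funV; apply: continuous_measurable_fun => v.
  by apply: cvgB; [exact: cvg_id | exact: cvg_cst].
have i1 := integrable_norm phi_int.
have i2 := integrableZl measurableT M (integrable_centered_indic 1 x).
apply: (le_integrable measurableT _ _ (integrableD measurableT i1 i2)).
  by apply/measurable_EFinP.
move=> v _ /=; rewrite lee_fin normrM normfV (le_trans (local_part_slope_le x v))//.
by rewrite ler_norm.
Qed.

(* The Lipschitz bound on phi cancels the pole at v = x; the window is then split at
   |v - x| = s, with rho = s^2. *)
Lemma kern_diff_le (s x v : R) : 0 < s ->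
  normc ((local_part x v)%:C *
    ((kern k (vline (s ^+ 2) x) v)^-1 - ('i * k%:C * (v - x)%:C)^-1)) <=
  M / `|k| * (centered_indic s x v + s / `|k| * window x v)
    + s ^+ 2 / `|k| ^+ 2 * `|phi v|.
Proof.
move=> s0.
have nk0 : 0 < `|k| by rewrite normr_gt0.
have M0 := lip_ge0.
have rhs1 : 0 <= M / `|k| * (centered_indic s x v + s / `|k| * window x v).
  rewrite !centered_indicE mulr_ge0 ?(divr_ge0 M0)// addr_ge0 ?ler0n//.
  by rewrite mulr_ge0 ?ler0n// divr_ge0// ltW.
have rhs2 : 0 <= s ^+ 2 / `|k| ^+ 2 * `|phi v|.
  by rewrite mulr_ge0// divr_ge0// exprn_ge0// ltW.
have [vx|vx] := eqVneq v x.
  have -> : local_part x v = 0.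
    by rewrite vx /local_part centered_indicE subrr normr0 ler01 mulr1n mul1r subrr.
  by rewrite mul0r normc0 addr_ge0.
have u0 : 0 < `|v - x| by rewrite normr_gt0 subr_eq0.
set n := normc (kern k (vline (s ^+ 2) x) v).
have n1 : s ^+ 2 <= n by exact: (Re_le_kern k (vline (s ^+ 2) x) v).
have n0 : 0 < n by apply: lt_le_trans n1; rewrite exprn_gt0.
have n2 : `|k| * `|v - x| <= n.
  have := Im_le_normc (kern k (vline (s ^+ 2) x) v).
  by rewrite -/n kern_vline /= normrM.
have -> : (kern k (vline (s ^+ 2) x) v)^-1 - ('i * k%:C * (v - x)%:C)^-1 =
    - (s ^+ 2)%:C * ((kern k (vline (s ^+ 2) x) v)^-1 * ('i * k%:C * (v - x)%:C)^-1).
  have h1 : kern k (vline (s ^+ 2) x) v != 0 by rewrite -normc_gt0.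
  have h2 : 'i * k%:C * (v - x)%:C != 0.
    by rewrite mulf_neq0 ?ik_neq0// -normc_gt0 normc_real.
  have -> : (s ^+ 2)%:C = kern k (vline (s ^+ 2) x) v - 'i * k%:C * (v - x)%:C.
    by rewrite kern_vline; apply: complex_ext => /=; ring.
  move: (kern _ _ _) ('i * _ * _) h1 h2 => p q p0 q0.
  by field; apply/andP; split.
rewrite !normcM !normcV normc_opp !normcM normc_i mul1r !normc_real -/n.
rewrite (ger0_norm (exprn_ge0 2 (ltW s0))).
rewrite invfM.
rewrite (_ : _ * _ = `|local_part x v| * `|v - x|^-1 * (s ^+ 2 / n / `|k|)); last by ring.
have lp0 : 0 <= `|local_part x v| * `|v - x|^-1 by rewrite mulr_ge0.
have q0 : 0 <= s ^+ 2 / n / `|k| by rewrite !divr_ge0 ?exprn_ge0 ?ltW.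
have [v1|v1] := leP `|v - x| 1.
  rewrite ler_wpDr//.
  apply: (@le_trans _ _ (M * (s ^+ 2 / n / `|k|))).
    apply: ler_wpM2r => //.
    rewrite /local_part centered_indicE v1 mulr1n mul1r ler_pdivrMr//.
  rewrite -[leRHS]mulrA ler_wpM2l// [leRHS]mulrC ler_wpM2r ?invr_ge0//.
  rewrite !centered_indicE v1 mulr1n mulr1.
  (* For |v - x| <= s the bound n >= s^2 gives s^2 / n <= 1; beyond s, n >= |k| |v - x| gives s^2 /
     n <= s / |k|. *)
  have [vs|vs] := leP `|v - x| s.
    rewrite mulr1n; apply: ler_wpDr; first by rewrite divr_ge0// ltW.
    by rewrite ler_pdivrMr// mul1r.
  rewrite mulr0n add0r ler_pdivrMr//.
  apply: (@le_trans _ _ (s / `|k| * (`|k| * `|v - x|))); last first.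
    by rewrite ler_wpM2l// divr_ge0 ?ltW.
  by rewrite mulrA divfK ?gt_eqF// expr2 ler_wpM2l ?ltW.
rewrite ler_wpDl//.
rewrite /local_part centered_indicE (lt_geF v1) mulr0n mul0r subr0.
rewrite mulrC ler_pM//.
  have -> : s ^+ 2 / `|k| ^+ 2 = s ^+ 2 / `|k| / `|k| by field; rewrite gt_eqF.
  rewrite ler_wpM2r ?invr_ge0// ler_wpM2l ?exprn_ge0 ?(ltW s0)//.
  rewrite lef_pV2 ?posrE//; apply: le_trans n2.
  by rewrite ler_peMr// ltW.
by rewrite ler_piMr// invf_le1// ltW.
Qed.

Lemma atan_large (eta : R) : 0 < eta -> exists2 r : R, 0 < r &
  forall rho : R, 0 < rho -> rho <= r -> `|2 * atan (k / rho) - Num.sg k * pi| <= eta.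
Proof.
move=> eta0.
have /cvgrPdist_lt /(_ (eta / 2)) := @cvgy_atan R.
rewrite divr_gt0// => /(_ isT) [T [_ hT]].
have nk0 : 0 < `|k| by rewrite normr_gt0.
pose T' := Num.max T 0 + 1.
have T'0 : 0 < T' by rewrite ltr_wpDl// le_max lexx orbT.
have TT' : T < T' by rewrite ltr_pwDr// le_max lexx.
exists (`|k| / T'); first by rewrite divr_gt0.
move=> rho rho0; rewrite ler_pdivlMr// mulrC -ler_pdivlMr// => rr.
have := hT _ (lt_le_trans TT' rr).
have -> : 2 * atan (k / rho) - Num.sg k * pi = Num.sg k * (2 * atan (`|k| / rho) - pi).
  case: (ltgtP k 0) k0 => // kk _.
  - by rewrite ltr0_sg// ltr0_norm// (mulNr k) atanN; ring.
  - by rewrite gtr0_sg// gtr0_norm//; ring.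
rewrite normrM normr_sg k0 mul1r => h.
rewrite (_ : _ - pi = - (2 * (pi / 2 - atan (`|k| / rho)))); last by field.
rewrite normrN normrM (ger0_norm (ler0n _ 2)).
by rewrite mulrC -ler_pdivlMr// ltW.
Qed.

(** With phi = [local_part x] + phi x * [window x], the first summand is integrated against the
    limit kernel plus the kernel difference, the second exactly. The right side does not depend on
    x, whence the uniform convergence to the boundary. *)
Lemma boundary_estimate (s x : R) : 0 < s ->
  normc (deflated phi k [::] (vline (s ^+ 2) x) - boundary_curve x) <=
  2 / `|k| * (M / `|k| * (2 * s + s / `|k| * 2) + s ^+ 2 / `|k| ^+ 2 * L1norm phi)
  + B / k ^+ 2 * `|2 * atan (k / s ^+ 2) - Num.sg k * pi|.
Proof.
move=> s0.
have s20 : 0 < s ^+ 2 by rewrite exprn_gt0.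
have nk0 : 0 < `|k| by rewrite normr_gt0.
set l := vline (s ^+ 2) x.
have l0 : 0 < Re l by [].
have ik0 : 'i * k%:C != 0 by exact: ik_neq0.
pose diffk v := (kern k l v)^-1 - ('i * k%:C * (v - x)%:C)^-1.
pose g v := M / `|k| * (centered_indic s x v + s / `|k| * window x v)
    + s ^+ 2 / `|k| ^+ 2 * `|phi v|.
have iZ (c : R) (h : R -> R) : mu.-integrable setT (EFin \o h) ->
    mu.-integrable setT (EFin \o (fun v => c * h v)).
  by move=> /(integrableZl measurableT c).
have iD (h1 h2 : R -> R) : mu.-integrable setT (EFin \o h1) ->
    mu.-integrable setT (EFin \o h2) ->
    mu.-integrable setT (EFin \o (fun v => h1 v + h2 v)).
  by move=> i1 i2; exact: (integrableD measurableT i1 i2).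
have ic r := integrable_centered_indic r x.
have iphin := integrable_norm phi_int.
have ig : mu.-integrable setT (EFin \o g).
  by apply: (iD); [apply: (iZ); apply: (iD) => //; apply: iZ | exact: iZ].
have gE : \int[mu]_v g v =
    M / `|k| * (2 * s + s / `|k| * 2) + s ^+ 2 / `|k| ^+ 2 * L1norm phi.
  rewrite RintegralD//; [|by apply: (iZ); apply: (iD) => //; apply: iZ|exact: iZ].
  rewrite !RintegralZl//; last by apply: (iD) => //; apply: iZ.
  rewrite RintegralD//; last exact: iZ.
  by rewrite RintegralZl// !Rintegral_centered_indic ?ler01 ?(ltW s0)// mulr1.
have mlp := cmeasurable_real (measurable_local_part x).
have mk : cmeasurable (fun v => (kern k l v)^-1).
  exact/ccontinuous_cmeasurable/ccontinuous_kernV.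
have mu1 : cmeasurable (fun v => ('i * k%:C * (v - x)%:C)^-1).
  have -> : (fun v => ('i * k%:C * (v - x)%:C)^-1) =
            (fun v => ('i * k%:C)^-1 * ((v - x)^-1)%:C).
    by apply/funext => v; rewrite invfM fmorphV.
  apply: cmeasurableM.
    exact/ccontinuous_cmeasurable/ccontinuous_cst.
  apply: cmeasurable_real; apply: measurable_funV; apply: continuous_measurable_fun => v.
  by apply: cvgB; [exact: cvg_id | exact: cvg_cst].
have mdiff : cmeasurable diffk.
  case: mk mu1 => [a1 a2] [b1 b2]; split.
  - by under eq_fun do rewrite /diffk Re_add Re_opp; exact: measurable_funB.
  - by under eq_fun do rewrite /diffk Im_add Im_opp; exact: measurable_funB.
have mF := cmeasurableM mlp mdiff.
have Fg v := kern_diff_le x v s0.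
have iF := le_cintegrable mF ig Fg.
have bF := normc_cint_le mF ig Fg.
rewrite gE in bF.
have iS : cintegrable (fun v => (local_part x v / (v - x))%:C).
  by split; [exact: integrable_local_slope | exact: integrable0].
have iW : cintegrable (fun v => (window x v)%:C * (kern k l v)^-1).
  apply: (@le_cintegrable _ _ (fun v => (s ^+ 2)^-1 * window x v)).
  - apply: cmeasurableM => //; apply: cmeasurable_real; exact: measurable_indic.
  - exact: iZ.
  - move=> v; rewrite normcM normc_real centered_indicE normr_nat mulrC.
    rewrite ler_wpM2r// normc_kernV//.
have iS' := cintegrableZ ('i * k%:C)^-1 iS.
have iW' := cintegrableZ (phi x)%:C iW.
have cE : cint (fun v => (phi v)%:C * (blaschke k [::] v / kern k l v)) =
    cint (fun v => (local_part x v)%:C * diffk v) +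
    ('i * k%:C)^-1 * cint (fun v => (local_part x v / (v - x))%:C) +
    (phi x)%:C * (2 / k * atan (k / s ^+ 2))%:C.
  rewrite -(window_kern_cint x s20) -/l -!cintZ// -!cintD//; last first.
    exact: cintegrableD.
  apply: eq_cint => v.
  rewrite /blaschke big_nil /diffk mul1r mulrBr.
  rewrite invfM rmorphM fmorphV /=.
  rewrite {1}(_ : phi v = local_part x v + phi x * window x v); last first.
    by rewrite /local_part; ring.
  by rewrite rmorphD rmorphM /=; ring.
rewrite /deflated cE.
set J := cint (fun v => (local_part x v)%:C * diffk v).
have -> : 1 + 1 / ('i * k%:C) *
   (J + ('i * k%:C)^-1 * cint (fun v => (local_part x v / (v - x))%:C) +
    (phi x)%:C * (2 / k * atan (k / s ^+ 2))%:C) - boundary_curve x =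
   1 / ('i * k%:C) * J +
   0 +i* (- (phi x / k ^+ 2 * (2 * atan (k / s ^+ 2) - Num.sg k * pi))).
  have -> : cint (fun v => (local_part x v / (v - x))%:C) =
     (\int[mu]_v ((phi v - window x v * phi x) / (v - x)))%:C.
    apply: complex_ext => //=.
    by rewrite /Rintegral integral0.
  have iE : 1 / ('i * k%:C) = 0 +i* (- k^-1) :> R[i].
    by apply: (mulIf ik0); rewrite divfK//; apply: complex_ext => /=; field.
  have iE' : ('i * k%:C)^-1 = 0 +i* (- k^-1) :> R[i] by rewrite -iE mul1r.
  rewrite iE iE' /boundary_curve; case: (J) => J1 J2.
  move: (Rintegral _ _ _) (atan _) (Num.sg k) (@pi R) => I a g0 p.
  by apply: complex_ext => /=; field.
rewrite (le_trans (normcD _ _))// lerD//.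
  rewrite normcM mul1r normcV normc_ik.
  rewrite mulrC (le_trans (ler_wpM2r _ bF)) ?invr_ge0//.
  by rewrite le_eqVlt; apply/orP; left; apply/eqP; ring.
rewrite /= expr0n/= add0r sqrrN sqrtr_sqr normrM ler_wpM2r// normrM.
rewrite normfV normrX real_normK ?num_real// ler_wpM2r ?invr_ge0 ?sqr_ge0//.
Qed.

Lemma boundary_limit (eta : R) : 0 < eta -> exists2 r : R, 0 < r &
  forall rho x : R, 0 < rho -> rho <= r ->
    normc (deflated phi k [::] (vline rho x) - boundary_curve x) <= eta.
Proof.
move=> eta0.
have nk0 : 0 < `|k| by rewrite normr_gt0.
have k20 : 0 < k ^+ 2 by rewrite exprn_even_gt0.
have B0 := phi_B_ge0. have M0 := lip_ge0. have L0 := L1norm_ge0 phi.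
pose e2 := eta / 2 / (B / k ^+ 2 + 1).
have Bk0 : 0 <= B / k ^+ 2 by rewrite divr_ge0// ltW.
have Bk1 : 0 < B / k ^+ 2 + 1 by rewrite ltr_wpDl.
have e20 : 0 < e2 by rewrite !divr_gt0.
have [r r0 hr] := atan_large e20.
(* As s^2 <= s for s <= 1, the first term of [boundary_estimate] is then at most K s. *)
pose K := 2 / `|k| * (M / `|k| * (2 + `|k|^-1 * 2) + (`|k| ^+ 2)^-1 * L1norm phi).
have K0 : 0 <= K.
  by rewrite /K !(mulr_ge0, addr_ge0, divr_ge0, invr_ge0, exprn_ge0)// ?invr_ge0 ?exprn_ge0.
pose s0 := Num.min 1 (eta / 2 / (K + 1)).
have K1 : 0 < K + 1 by rewrite ltr_wpDl.
have s00 : 0 < s0 by rewrite lt_min ltr01 !divr_gt0.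
exists (Num.min r (s0 ^+ 2)); first by rewrite lt_min r0 exprn_gt0.
move=> rho x rho0; rewrite le_min => /andP[rr rs].
pose s := Num.sqrt rho.
have s_gt0 : 0 < s by rewrite sqrtr_gt0.
have sE : s ^+ 2 = rho by rewrite sqr_sqrtr// ltW.
have ss0 : s <= s0 by rewrite -(@ler_pXn2r _ 2) ?nnegrE ?(ltW s_gt0) ?(ltW s00)// sE.
have := boundary_estimate x s_gt0; rewrite sE.
move=> /le_trans; apply.
have -> : eta = eta / 2 + eta / 2 by field.
apply: lerD.
  apply: (@le_trans _ _ (K * s)).
    have -> : K * s = 2 / `|k| * (M / `|k| * (2 * s + s / `|k| * 2) + s / `|k| ^+ 2 * L1norm phi).
      by rewrite /K; ring.
    rewrite ler_wpM2l ?divr_ge0// lerD2l ler_wpM2r// ler_wpM2r ?invr_ge0 ?exprn_ge0//.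
    rewrite -sE expr2 ler_piMr ?(ltW s_gt0)//.
    by rewrite (le_trans ss0)// ge_min lexx.
  apply: (@le_trans _ _ (K * s0)); first by rewrite ler_wpM2l.
  apply: (@le_trans _ _ ((K + 1) * (eta / 2 / (K + 1)))).
    apply: ler_pM => //; [exact: ltW|by rewrite lerDl|by rewrite /s0 ge_min lexx orbT].
  by rewrite mulrC divfK ?gt_eqF.
apply: (@le_trans _ _ (B / k ^+ 2 * e2)); first by rewrite ler_wpM2l// hr.
apply: (@le_trans _ _ ((B / k ^+ 2 + 1) * e2)); first by rewrite ler_wpM2r ?lerDl// ltW.
by rewrite /e2 mulrC divfK ?gt_eqF.
Qed.

End BoundaryValues.

(** * Continuous arguments along curves *)

Section Connectedness.
Context {R : realType}.

(** Connectedness of [a, b] by an infimum argument: near the infimum of the points satisfying P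
    there is such a point, and P passes from it to points further left. *)
Lemma locally_constant_left (P : R -> Prop) (a b : R) : a <= b ->
  (forall c, a <= c <= b -> exists2 d : R, 0 < d & forall x y, a <= x <= b ->
     a <= y <= b -> `|x - c| < d -> `|y - c| < d -> P x -> P y) ->
  P b -> P a.
Proof.
move=> ab loc Pb.
pose S := [set x | a <= x <= b /\ P x].
have Sb : S b by split => //; rewrite ab lexx.
have Sinf : has_inf S.
  by split; [exists b | exists a => x [/andP[]]].
have aS : a <= inf S by apply: lb_le_inf; [exists b|move=> x [/andP[]]].
have Sb' : inf S <= b by apply: ge_inf => //; case: Sinf.
have Iab : a <= inf S <= b by rewrite aS.
have [d d0 hd] := loc _ Iab.
have [s [sab Ps] sd] := inf_adherent d0 Sinf.
have sI : inf S <= s by apply: ge_inf => //; case: Sinf.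
have sd' : `|s - inf S| < d by rewrite ger0_norm ?subr_ge0// ltrBlDl.
(* A point to the left of the infimum, cut off at a. As it satisfies P it cannot lie below the
   infimum, so the cut-off was effective and y = a. *)
pose y := Num.max a (inf S - d / 2).
have ya : a <= y by rewrite le_max lexx.
have yI : y <= inf S by rewrite ge_max aS lerBlDr lerDl divr_ge0 ?ltW.
have yd : `|y - inf S| < d.
  rewrite ler0_norm ?subr_le0// opprB ltrBlDr -ltrBlDl lt_max; apply/orP; right.
  by rewrite ltrD2l ltrN2; lra.
have yab : a <= y <= b by rewrite ya (le_trans yI).
have Py : P y by exact: hd Ps.
have Iy : inf S <= y by apply: ge_inf => //; case: Sinf.
suff -> : a = y by [].
apply/le_anti; rewrite ya /= /y ge_max lexx /= leNgt; apply/negP => h.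
have : y < inf S \/ y = a by right; rewrite /y; apply/max_idPl; move: Iy; rewrite /y le_max; lra.
case; first by rewrite ltNge Iy.
move=> ya'; move: h; rewrite ya' in Iy.
have -> : inf S = a by apply/le_anti; rewrite Iy.
lra.
Qed.

Lemma locally_constant_right (P : R -> Prop) (a b : R) : a <= b ->
  (forall c, a <= c <= b -> exists2 d : R, 0 < d & forall x y, a <= x <= b ->
     a <= y <= b -> `|x - c| < d -> `|y - c| < d -> P x -> P y) ->
  P a -> P b.
Proof.
move=> ab loc; apply: contraPP => nPb.
apply: (@locally_constant_left (fun x => ~ P x) _ _ ab) => // c /loc[d d0 hd].
exists d => // x y xab yab xc yc; apply: contra_not; exact: hd.
Qed.

End Connectedness.

Section Lifts.
Context {R : realType}.
Implicit Types (g h : R -> R[i]) (th : R -> R).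

Definition limits_at_infinity th (a b : R) := forall eta : R, 0 < eta ->
  exists2 X : R, 0 < X & forall x,
    (x <= - X -> `|th x - a| <= eta) /\ (X <= x -> `|th x - b| <= eta).

Definition tends_to_1 g := forall eta : R, 0 < eta ->
  exists2 X : R, 0 < X & forall x, X <= `|x| -> normc (g x - 1) <= eta.

(** The argument itself stays hidden; b - a is its net variation along the curve, and r > 0 keeps
    the curve away from 0. *)
Definition has_lift g (a b : R) := exists th, [/\ continuous th,
  limits_at_infinity th a b &
  forall x, exists2 r : R, 0 < r & g x = (r * cos (th x)) +i* (r * sin (th x))].

Lemma limits_at_infinityD th1 th2 a1 b1 a2 b2 :
  limits_at_infinity th1 a1 b1 -> limits_at_infinity th2 a2 b2 ->
  limits_at_infinity (fun x => th1 x + th2 x) (a1 + a2) (b1 + b2).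
Proof.
move=> h1 h2 eta eta0; have e2 : 0 < eta / 2 by rewrite divr_gt0.
have [X X0 hX] := h1 _ e2; have [Y Y0 hY] := h2 _ e2.
exists (X + Y) => [|x]; first exact: addr_gt0.
have [hX1 hX2] := hX x; have [hY1 hY2] := hY x.
split => hx.
- have -> : th1 x + th2 x - (a1 + a2) = (th1 x - a1) + (th2 x - a2) by ring.
  apply: (le_trans (ler_normD _ _)).
  have := hX1 ltac:(lra); have := hY1 ltac:(lra); lra.
- have -> : th1 x + th2 x - (b1 + b2) = (th1 x - b1) + (th2 x - b2) by ring.
  apply: (le_trans (ler_normD _ _)).
  have := hX2 ltac:(lra); have := hY2 ltac:(lra); lra.
Qed.

Lemma has_liftM g h a1 b1 a2 b2 : has_lift g a1 b1 -> has_lift h a2 b2 ->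
  has_lift (fun x => g x * h x) (a1 + a2) (b1 + b2).
Proof.
move=> [t1 [c1 l1 e1]] [t2 [c2 l2 e2]]; exists (fun x => t1 x + t2 x); split.
- by move=> x; exact: (cvgD (c1 x) (c2 x)).
- exact: limits_at_infinityD.
- move=> x; have [r r0 ->] := e1 x; have [s s0 ->] := e2 x.
  exists (r * s); first exact: mulr_gt0.
  by rewrite cosD sinD; apply: complex_ext => /=; ring.
Qed.

Lemma eq_has_lift g h a b : g =1 h -> has_lift g a b -> has_lift h a b.
Proof. by move=> /funext ->. Qed.

Lemma tends_to_1_Re g : tends_to_1 g -> exists2 X : R, 0 < X & forall x,
  X <= `|x| -> 1 / 2 <= normc (g x).
Proof.
move=> /(_ (1 / 2)) []; first by rewrite divr_gt0.
move=> X X0 hX; exists X => // x /hX h.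
have := lerB_normc 1 (1 - g x).
rewrite (_ : 1 - (1 - g x) = g x); last by ring.
by rewrite normc1 (normc_subC 1); lra.
Qed.

Lemma polar_atan (z : R[i]) : 0 < Re z -> exists2 r : R, 0 < r &
  z = (r * cos (atan (Im z / Re z))) +i* (r * sin (atan (Im z / Re z))).
Proof.
move=> z0; set t := Im z / Re z.
have c0 : 0 < cos (atan t).
  by apply: cos_gt0_pihalf; rewrite atan_gtNpi2 atan_ltpi2.
exists (Re z / cos (atan t)); first exact: divr_gt0.
have st : sin (atan t) = t * cos (atan t).
  by rewrite -{2}(atanK t) /tan divfK// gt_eqF.
by apply: complex_ext => /=; rewrite ?st /t; field; rewrite !gt_eqF.
Qed.

Lemma atan_le_norm (t : R) : `|atan t| <= `|t|.
Proof.
wlog t0 : t / 0 <= t.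
  move=> h; have [/h//|t0] := leP 0 t.
  by rewrite -normrN -atanN -[leRHS]normrN h// oppr_ge0 ltW.
rewrite le_eqVlt in t0; case/predU1P: t0 => [<-|t0]; first by rewrite atan0 normr0.
have dat z : z \in `]0, t[ -> is_derive z 1 (@atan R) (1 + z ^+ 2)^-1.
  by move=> _; exact: is_derive1_atan.
have cat : {within `[0, t], continuous (@atan R)}.
  by apply: continuous_subspaceT => z; exact: continuous_atan.
have [c _ e] := MVT t0 dat cat.
rewrite atan0 !subr0 in e; rewrite e normrM ler_piMl// ger0_norm ?invr_ge0 ?addr_ge0 ?sqr_ge0//.
by rewrite invf_le1 ?lerDl ?sqr_ge0// ltr_pwDl// sqr_ge0.
Qed.

Lemma has_lift_Re_gt0 g : ccontinuous g -> tends_to_1 g ->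
  (forall x, 0 < Re (g x)) -> has_lift g 0 0.
Proof.
move=> [cRe cIm] g1 g0; exists (fun x => atan (Im (g x) / Re (g x))); split.
- move=> x; apply: (@continuous_comp _ _ _ (fun x => Im (g x) / Re (g x)) (@atan R)).
    apply: cvgM; first exact: cIm.
    apply: (@continuousV _ _ (fun x => Re (g x)) x _ (cRe x)).
    by rewrite gt_eqF.
  exact: continuous_atan.
- move=> eta eta0.
  (* Then Re (g x) >= 1/2 and |Im (g x)| <= eta / 2, so that their ratio is at most eta. *)
  pose e := Num.min (1 / 2) (eta / 2).
  have e0 : 0 < e by rewrite lt_min !divr_gt0.
  have [X X0 hX] := g1 _ e0; exists X => // x.
  suff h : X <= `|x| -> `|atan (Im (g x) / Re (g x)) - 0| <= eta.
    split=> hx; apply: h.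
      by have := ler_norm (- x); rewrite normrN; lra.
    by rewrite (le_trans hx)// ler_norm.
  move=> /hX; rewrite le_min subr0 => /andP[h1 h2].
  apply: (le_trans (atan_le_norm _)).
  have := Re_le_normc (g x - 1); have := Im_le_normc (g x - 1).
  rewrite Re_add Im_add Re_opp Im_opp /= oppr0 addr0 => i1 i2.
  have r2 : 1 / 2 <= Re (g x).
    by have := ler_norm (1 - Re (g x)); rewrite distrC; lra.
  rewrite normrM normfV (gtr0_norm (g0 x)) ler_pdivrMr//.
  have : eta * (1 / 2) <= eta * Re (g x) by rewrite ler_wpM2l// ltW.
  lra.
- by move=> x; exact: polar_atan.
Qed.

(** A Rouche condition: |h / g - 1| < 1 puts h / g in the right half-plane, where its argument tends
    to 0 at both ends, so h inherits the limits of g without change. *)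
Lemma has_lift_close g h a b : ccontinuous g -> ccontinuous h ->
  tends_to_1 g -> tends_to_1 h ->
  (forall x, normc (h x - g x) < normc (g x)) ->
  has_lift g a b -> has_lift h a b.
Proof.
move=> cg ch g1 h1 hg lg.
have g0 x : g x != 0 by rewrite -normc_gt0 (le_lt_trans (normc_ge0 _) (hg x)).
have q1 x : normc (h x / g x - 1) = normc (h x - g x) / normc (g x).
  by rewrite -normcV -normcM mulrBl divff.
have lq : has_lift (fun x => h x / g x) 0 0.
  apply: has_lift_Re_gt0.
  - by apply: ccontinuousM => //; exact: ccontinuousV.
  - move=> eta eta0; have [X X0 hX] := tends_to_1_Re g1.
    have e0 : 0 < eta / 4 by rewrite divr_gt0.
    have [Y Y0 hY] := g1 _ e0; have [Z Z0 hZ] := h1 _ e0.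
    exists (X + Y + Z) => [|x xXYZ]; first by rewrite !addr_gt0.
    have i1 := hX x ltac:(lra); have i2 := hY x ltac:(lra); have i3 := hZ x ltac:(lra).
    have gx : 0 < normc (g x) by rewrite normc_gt0.
    rewrite q1 ler_pdivrMr//.
    have -> : h x - g x = (h x - 1) - (g x - 1) by ring.
    have := normcB (h x - 1) (g x - 1).
    have : eta * (1 / 2) <= eta * normc (g x) by rewrite ler_wpM2l// ltW.
    lra.
  - move=> x; have gx : 0 < normc (g x) by rewrite normc_gt0.
    have := Re_le_normc (h x / g x - 1); rewrite q1 Re_add Re_opp /=.
    have : normc (h x - g x) / normc (g x) < 1 by rewrite ltr_pdivrMr// mul1r.
    by have := ler_norm (1 - Re (h x / g x)); rewrite distrC; lra.
have := has_liftM lg lq; rewrite !addr0; apply: eq_has_lift => x.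
by rewrite mulrCA divff// mulr1.
Qed.

(** Outside a compact interval the modulus is at least 1/2, inside it the minimum is attained. *)
Lemma normc_lower_bound g : ccontinuous g -> tends_to_1 g ->
  (forall x, g x != 0) -> exists2 m : R, 0 < m & forall x, m <= normc (g x).
Proof.
move=> [cRe cIm] g1 g0; have [X X0 hX] := tends_to_1_Re g1.
have cn : continuous (fun x => Re (g x) ^+ 2 + Im (g x) ^+ 2).
  by move=> v; exact: (cvgD (cvgM (cRe v) (cRe v)) (cvgM (cIm v) (cIm v))).
have XX : - X <= X by lra.
have [c _ hc] := @EVT_min R _ _ _ XX (continuous_subspaceT cn).
have gc : 0 < normc (g c) by rewrite normc_gt0.
exists (Num.min (1 / 2) (normc (g c))).
  by rewrite lt_min gc divr_gt0.
move=> x; rewrite ge_min; have [xX|xX] := leP X `|x|.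
  by rewrite hX.
apply/orP; right; rewrite -(@ler_pXn2r _ 2) ?nnegrE ?normc_ge0// !sqr_normc.
by apply: hc; rewrite in_itv /=; move: xX; rewrite ltr_norml; lra.
Qed.

(* A ratio of two nearby curves has positive real part, so that its argument is
   given by [atan]; no lifting theorem is needed. *)
Lemma has_lift_homotopy (G : R -> R -> R[i]) :
  (forall rho : R, 0 < rho -> ccontinuous (G rho)) ->
  (forall rho : R, 0 < rho -> tends_to_1 (G rho)) ->
  (forall rho : R, 0 < rho -> forall x, G rho x != 0) ->
  (forall e : R, 0 < e -> exists2 L : R, 0 <= L & forall rho rho' x : R,
     e <= rho -> e <= rho' -> normc (G rho x - G rho' x) <= L * `|rho - rho'|) ->
  (exists2 Y : R, 0 < Y & forall (rho x : R), Y <= rho -> normc (G rho x - 1) < 1) ->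
  forall rho : R, 0 < rho -> has_lift (G rho) 0 0.
Proof.
move=> cG G1 G0 lipG [Y Y0 hY] rho rho0.
have [Yr|rY] := leP Y rho.
  apply: has_lift_Re_gt0; [exact: cG|exact: G1|] => x.
  have := Re_le_normc (G rho x - 1); rewrite Re_add Re_opp /=.
  by have := hY _ x Yr; have := ler_norm (1 - Re (G rho x)); rewrite distrC; lra.
(* The lift is carried from the abscissa Y, where the curve is near 1, leftwards to rho. *)
apply: (@locally_constant_left _ (fun r => has_lift (G r) 0 0) _ _ (ltW rY)); last first.
  apply: has_lift_Re_gt0; [exact: cG|exact: G1|] => x.
  have := Re_le_normc (G Y x - 1); rewrite Re_add Re_opp /=.
  by have := hY _ x (lexx Y); have := ler_norm (1 - Re (G Y x)); rewrite distrC; lra.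
move=> c /andP[rc cY]; have c0 : 0 < c by exact: lt_le_trans rc.
have [m m0 hm] := normc_lower_bound (cG _ c0) (G1 _ c0) (G0 _ c0).
have [L L0 hL] := lipG _ rho0.
(* Both curves are then within m/4 of [G c], so |G x| >= 3m/4 exceeds |G y - G x| <= m/2. *)
pose d := m / (4 * (L + 1)).
have L1 : 0 < L + 1 by rewrite ltr_wpDl.
have d0 : 0 < d by rewrite divr_gt0// mulr_gt0.
exists d => // x y /andP[rx xY] /andP[ry yY] xc yc.
have x0 : 0 < x by exact: lt_le_trans rx.
have y0 : 0 < y by exact: lt_le_trans ry.
have close z w : rho <= z -> `|z - c| < d -> normc (G z w - G c w) <= m / 4.
  move=> rz zc; apply: (le_trans (hL _ _ _ rz rc)).
  apply: (@le_trans _ _ ((L + 1) * d)).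
    by apply: ler_pM => //; [rewrite lerDl|exact: ltW].
  by have -> : (L + 1) * d = m / 4 by rewrite /d; field; rewrite gt_eqF.
apply: has_lift_close; [exact: cG|exact: cG|exact: G1|exact: G1|] => w.
have h1 := close x w rx xc; have h2 := close y w ry yc.
have := lerB_normc (G c w) (G c w - G x w); have := hm w.
have -> : G c w - (G c w - G x w) = G x w by ring.
have -> : G y w - G x w = (G y w - G c w) - (G x w - G c w) by ring.
have := normcB (G y w - G c w) (G x w - G c w).
rewrite (normc_subC (G c w)); lra.
Qed.

Lemma limits_atan_affine (c d : R) : c != 0 ->
  limits_at_infinity (fun x => atan (c * x + d)) (- (Num.sg c * (pi / 2))) (Num.sg c * (pi / 2)).
Proof.
move=> c0 eta eta0.
have /cvgrPdist_lt /(_ _ eta0) [T [_ hT]] := @cvgy_atan R.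
have nc0 : 0 < `|c| by rewrite normr_gt0.
pose X := (`|T| + `|d| + 1) / `|c|.
have X0 : 0 < X by rewrite divr_gt0// ltr_wpDl// addr_ge0.
have XE : `|c| * X = `|T| + `|d| + 1 by rewrite /X mulrC divfK// gt_eqF.
(* Oddness of [atan] reduces both ends and both signs of c to this case, with e = d or e = -d. *)
have up y : X <= y -> forall e, `|e| <= `|d| -> `|atan (`|c| * y + e) - pi / 2| <= eta.
  move=> Xy e ed; rewrite distrC ltW// hT//.
  have : `|c| * X <= `|c| * y by rewrite ler_wpM2l.
  by rewrite XE; have := ler_norm T; have := lerNnormlW (lexx `|e|); lra.
exists X => // x; split => hx.
- have Xx : X <= - x by rewrite lerNr.
  case: (ltgtP c 0) c0 => // cc _.
  + have -> : c * x + d = `|c| * (- x) + d by rewrite ltr0_norm//; ring.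
    by rewrite ltr0_sg// mulN1r opprK; exact: up.
  + have -> : c * x + d = - (`|c| * (- x) + - d) by rewrite gtr0_norm//; ring.
    by rewrite gtr0_sg// mul1r atanN -opprB normrN opprK addrC; apply: up; rewrite ?normrN.
- case: (ltgtP c 0) c0 => // cc _.
  + have -> : c * x + d = - (`|c| * x + - d) by rewrite ltr0_norm//; ring.
    by rewrite ltr0_sg// mulN1r atanN -opprB normrN opprK addrC up ?normrN.
  + have -> : c * x + d = `|c| * x + d by rewrite gtr0_norm.
    by rewrite gtr0_sg// mul1r up.
Qed.

Lemma has_lift_affine (k a b : R) : k != 0 -> 0 < a ->
  has_lift (fun x => a +i* (k * x + b)) (- (Num.sg k * (pi / 2))) (Num.sg k * (pi / 2)).
Proof.
move=> k0 a0; exists (fun x => atan (k / a * x + b / a)).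
have <- : Num.sg (k / a) = Num.sg k.
  by rewrite sgrM (gtr0_sg (_ : 0 < a^-1)) ?mulr1// invr_gt0.
split.
- move=> x; apply: (@continuous_comp _ _ _ (fun x => k / a * x + b / a) (@atan R));
    last exact: continuous_atan.
  by apply: cvgD; [apply: cvgM; [exact: cvg_cst|exact: cvg_id]|exact: cvg_cst].
- by apply: limits_atan_affine; rewrite mulf_neq0// invr_neq0// gt_eqF.
- move=> x; have [r r0 e] := @polar_atan (a +i* (k * x + b)) a0; exists r => //.
  rewrite {1}e /=.
  by have -> : (k * x + b) / a = k / a * x + b / a by ring.
Qed.

Lemma has_lift_cst (r c : R) : 0 < r -> has_lift (fun=> (r * cos c) +i* (r * sin c)) c c.
Proof.
move=> r0; exists (fun=> c); split; first by move=> x; exact: cvg_cst.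
- by move=> eta /ltW eta0; exists 1 => // x; rewrite subrr normr0.
- by move=> x; exists r.
Qed.

Lemma has_lift_inv g a b : has_lift g a b -> has_lift (fun x => (g x)^-1) (- a) (- b).
Proof.
move=> [th [c l e]]; exists (fun x => - th x); split.
- by move=> x; exact: (cvgN (c x)).
- move=> eta eta0; have [X X0 hX] := l _ eta0; exists X => // x.
  by have := hX x; rewrite -!opprD !normrN.
- move=> x; have [r r0 ->] := e x; exists r^-1; first by rewrite invr_gt0.
  rewrite cosN sinN; have := cos2Dsin2 (th x) => cs.
  have n : (r * cos (th x)) ^+ 2 + (r * sin (th x)) ^+ 2 = r ^+ 2.
    by rewrite !exprMn -mulrDr cs mulr1.
  by apply: complex_ext; rewrite ?Re_inv ?Im_inv /= n; field; rewrite gt_eqF.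
Qed.

Lemma has_lift_conj g a b : has_lift g a b -> has_lift (fun x => conjc (g x)) (- a) (- b).
Proof.
move=> [th [c l e]]; exists (fun x => - th x); split.
- by move=> x; exact: (cvgN (c x)).
- move=> eta eta0; have [X X0 hX] := l _ eta0; exists X => // x.
  by have := hX x; rewrite -!opprD !normrN.
- move=> x; have [r r0 ->] := e x; exists r => //.
  by rewrite cosN sinN; apply: complex_ext => //=; rewrite mulrN.
Qed.

End Lifts.

(** * Counting crossings of the negative real axis *)

Section CrossingCount.
Context {R : realType}.
Local Notation twopi := (2 * pi : R).

Lemma cosD_int (t : R) (n : int) : cos (t + twopi * n%:~R) = cos t.
Proof.
have nat_case (u : R) (m : nat) : cos (u + twopi * m%:R) = cos u.
  have -> : twopi * m%:R = (pi *+ 2) *+ m.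
    by rewrite -(mulr_natr (pi *+ 2)) -(mulr_natl pi).
  exact: (periodicn (@cosD2pi R)).
case: n => m; first exact: nat_case.
rewrite NegzE mulrNz mulrN -[RHS](nat_case _ m.+1).
rewrite -[RHS](nat_case _ 0%N) mulr0 addr0 -(nat_case (t - _) m.+1).
by rewrite subrK (nat_case t).
Qed.

Lemma sinD_int (t : R) (n : int) : sin (t + twopi * n%:~R) = sin t.
Proof. by rewrite -!cosBpihalf -[RHS](cosD_int _ n); congr cos; ring. Qed.

(* The n such that t lies in [2 pi n - pi, 2 pi n + pi[. *)
Definition sheet (t : R) : int := Num.floor ((t + pi) / twopi).

Lemma twopi_gt0 : 0 < twopi.
Proof. by rewrite mulr_gt0// pi_gt0. Qed.

Lemma sheet_itv t : twopi * (sheet t)%:~R - pi <= t < twopi * (sheet t)%:~R + pi.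
Proof.
have p0 := twopi_gt0.
have /andP[] := floor_itv ((t + pi) / twopi); rewrite -/(sheet t).
rewrite ler_pdivlMr// ltr_pdivrMr// rmorphD /= => h1 h2.
by apply/andP; split; [lra|move: h2; rewrite mulrDl mul1r; lra].
Qed.

Lemma sheet_eq t n : twopi * n%:~R - pi <= t < twopi * n%:~R + pi -> sheet t = n.
Proof.
move=> /andP[h1 h2]; have p0 := twopi_gt0.
apply: floor_def; rewrite ler_pdivlMr// ltr_pdivrMr// rmorphD /= mulrDl mul1r.
by apply/andP; split; lra.
Qed.

Lemma cos_sheet (n : int) : cos (twopi * n%:~R - pi) = -1.
Proof. by rewrite addrC cosD_int cosN cospi. Qed.

Lemma cos_gtN1 (t : R) : `|t| < pi -> -1 < cos t.
Proof.
have p0 := @pi_gt0 R; rewrite -cos_norm => tp.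
by rewrite -cospi ltr_cos// in_itv /= ?lexx ?normr_ge0 ?ltW.
Qed.

Lemma cosN1_sheet t : cos t = -1 -> t = twopi * (sheet t)%:~R - pi.
Proof.
move=> ct; have /andP[h1 h2] := sheet_itv t; set n := sheet t in h1 h2 *.
apply/eqP; rewrite eq_le h1 andbT leNgt; apply/negP => h3.
have := @cos_gtN1 (t + twopi * (- n)%:~R); rewrite cosD_int ct ltxx => h.
suff : is_true false by []; apply: h.
rewrite mulrNz mulrN ltr_norml; apply/andP; split; lra.
Qed.

Variable th : R -> R.
Hypothesis th_cont : continuous th.

(** To change sheets [th] must take, by the intermediate value theorem, the left end of the higher
    one, where the cosine is -1. *)
Lemma sheet_const (c d : R) : c <= d ->
  (forall x, c <= x <= d -> cos (th x) != -1) -> sheet (th c) = sheet (th d).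
Proof.
move=> cd nocross; have p0 := twopi_gt0.
have ivt v : Num.min (th c) (th d) <= v <= Num.max (th c) (th d) ->
    exists2 x, c <= x <= d & th x = v.
  move=> hv; have [x] := IVT cd (continuous_subspaceT th_cont) hv.
  by rewrite in_itv /= => cxd <-; exists x.
have /andP[c1 c2] := sheet_itv (th c); have /andP[d1 d2] := sheet_itv (th d).
have step (m n : int) : m < n -> twopi * m%:~R + twopi <= twopi * n%:~R.
  move=> mn; have : (m + 1)%:~R <= n%:~R :> R by rewrite ler_int lezD1.
  rewrite rmorphD /= => h; have : twopi * (m%:~R + 1) <= twopi * n%:~R by rewrite ler_wpM2l// ltW.
  by rewrite mulrDr mulr1.
case: (ltgtP (sheet (th c)) (sheet (th d))) => // /step h.
- have [x cxd e] : exists2 x, c <= x <= d & th x = twopi * (sheet (th d))%:~R - pi.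
    by apply: ivt; rewrite ge_min le_max d1 orbT andbT; apply/orP; left; lra.
  by have := nocross _ cxd; rewrite e cos_sheet eqxx.
- have [x cxd e] : exists2 x, c <= x <= d & th x = twopi * (sheet (th c))%:~R - pi.
    by apply: ivt; rewrite ge_min le_max c1 /= andbT; apply/orP; right; lra.
  by have := nocross _ cxd; rewrite e cos_sheet eqxx.
Qed.

(* [e = 1] for a counterclockwise crossing, [e = -1] for a clockwise one *)
Definition crossing (e : R) (s : R) := cos (th s) = -1 /\
  exists2 d : R, 0 < d & forall x,
    (s - d < x < s -> 0 < e * sin (th x)) /\ (s < x < s + d -> e * sin (th x) < 0).

Lemma th_near (s e : R) : 0 < e ->
  exists2 d : R, 0 < d & forall x, `|x - s| < d -> `|th x - th s| < e.
Proof.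
move=> e0; have /(_ s) /cvgrPdist_lt /(_ _ e0) := th_cont.
move=> /nbhs_ballP [d d0 hd]; exists d => // x xs.
by rewrite distrC; apply: hd; rewrite /ball /= distrC.
Qed.

Lemma sin_sheet (n : int) (t : R) : sin (twopi * n%:~R - pi + t) = - sin t.
Proof.
have -> : twopi * n%:~R - pi + t = t - pi + twopi * n%:~R by ring.
by rewrite sinD_int sinB cospi sinpi; ring.
Qed.

(** At a crossing [th s] is the left end of its sheet n. Within distance pi of it the sign of the
    sine tells the side, so [th] passes from sheet n - 1 into sheet n. *)
Lemma sheet_crossing_ccw s : crossing 1 s -> exists2 d : R, 0 < d & forall x y,
  s - d < x < s -> s < y < s + d -> sheet (th y) - sheet (th x) = 1.
Proof.
move=> [cs [d d0 hd]]; have p0 := @pi_gt0 R.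
have [d' d'0 hd'] := th_near s p0.
exists (Num.min d d'); first by rewrite lt_min d0.
move=> x y /andP[sx xs] /andP[sy ys].
have m1 : Num.min d d' <= d by rewrite ge_min lexx.
have m2 : Num.min d d' <= d' by rewrite ge_min lexx orbT.
have hx : `|th x - th s| < pi by apply: hd'; rewrite ltr_norml; lra.
have hy : `|th y - th s| < pi by apply: hd'; rewrite ltr_norml; lra.
have [+ _] := hd x; have [_ +] := hd y.
rewrite !mul1r => /(_ ltac:(lra)) ny /(_ ltac:(lra)) px.
have es := cosN1_sheet cs; set n := sheet (th s) in es.
have ex : th x = twopi * n%:~R - pi + (th x - th s) by rewrite es; ring.
have ey : th y = twopi * n%:~R - pi + (th y - th s) by rewrite es; ring.
move: px ny; rewrite {1}ex {1}ey !sin_sheet oppr_gt0 oppr_lt0.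
move: hx hy; rewrite !ltr_norml => /andP[x1 x2] /andP[y1 y2] px ny.
have tx : th x - th s < 0.
  rewrite ltNge; apply/negP => h; have := @sin_ge0_pi R (th x - th s).
  by rewrite h ltW//= [0 <= sin _]leNgt px => /(_ isT).
have ty : 0 < th y - th s.
  rewrite ltNge; apply/negP => h; have := @sin_ge0_pi R (- (th y - th s)).
  by rewrite oppr_ge0 h sinN oppr_ge0 [sin _ <= 0]leNgt ny lerNl ltW// => /(_ isT).
have -> : sheet (th x) = n - 1.
  by apply: sheet_eq; rewrite rmorphB /= mulrBr mulr1; lra.
have -> : sheet (th y) = n by apply: sheet_eq; lra.
by rewrite opprB addrC subrK.
Qed.

Lemma sheet_sum (e : R -> int) (l : seq R) (c d : R) : c < d ->
  sorted <%R l -> {in l, forall x, c < x < d} ->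
  (forall x, c <= x <= d -> cos (th x) = -1 -> x \in l) ->
  {in l, forall s, exists2 h : R, 0 < h & forall x y,
    s - h < x < s -> s < y < s + h -> sheet (th y) - sheet (th x) = e s} ->
  sheet (th d) - sheet (th c) = \sum_(s <- l) e s.
Proof.
elim: l c => [|s l ih] c cd sl lcd all_cross jump.
  rewrite big_nil (@sheet_const c d) ?subrr ?ltW// => x xcd; apply/eqP => xc.
  by have := all_cross _ xcd xc.
have /andP[cs sd] : c < s < d by apply: lcd; rewrite mem_head.
have sl' : all (> s) l by apply: order_path_min => //; exact: lt_trans.
have [h h0 hs] := jump s (mem_head _ _).
(* The next crossing after s, or d if there is none. *)
pose u := head d l.
have su : s < u.
  by rewrite /u; case: (l) sl' => [//|s' l' /= /andP[]].
have ud : u <= d.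
  rewrite /u; case: (l) lcd => [//|s' l' /= h'].
  by have /andP[_ /ltW] : c < s' < d by apply: h'; rewrite !inE eqxx orbT.
have ul x : x \in l -> u <= x.
  rewrite /u; case: (l) sl => [//|s' l' /= /andP[_ s'l']].
  rewrite inE => /predU1P[->//|xl'].
  have /allP /(_ _ xl') : all (> s') l' by apply: order_path_min => //; exact: lt_trans.
  exact: ltW.
(* Midpoints, so that s is the only crossing in [c, y] and both points are within h of s; the
   induction continues from y. *)
pose x := (s + Num.max c (s - h)) / 2; pose y := (s + Num.min u (s + h)) / 2.
have m1 : Num.max c (s - h) < s by rewrite gt_max cs ltrBlDr ltrDl.
have m2 : s < Num.min u (s + h) by rewrite lt_min su ltrDl.
have m3 : c <= Num.max c (s - h) by rewrite le_max lexx.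
have m4 : s - h <= Num.max c (s - h) by rewrite le_max lexx orbT.
have m5 : Num.min u (s + h) <= u by rewrite ge_min lexx.
have m6 : Num.min u (s + h) <= s + h by rewrite ge_min lexx orbT.
have xs : x < s by rewrite /x; lra.
have sy : s < y by rewrite /y; lra.
have yu : y < u by rewrite /y; lra.
have cx : sheet (th c) = sheet (th x).
  apply: sheet_const; first by rewrite /x; lra.
  move=> z /andP[cz zx]; apply/eqP => zc.
  have := all_cross z; rewrite cz (le_trans zx) ?(le_trans (ltW xs)) ?ltW// => /(_ isT zc).
  rewrite inE => /predU1P[zs|/(allP sl') sz].
    by move: zx; rewrite zs leNgt xs.
  by have := lt_trans (le_lt_trans zx xs) sz; rewrite ltxx.
have xy : sheet (th y) - sheet (th x) = e s.
  by apply: hs; apply/andP; split => //; rewrite /x /y; lra.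
have yd : sheet (th d) - sheet (th y) = \sum_(s <- l) e s.
  apply: ih.
  - exact: lt_le_trans ud.
  - exact: path_sorted sl.
  - move=> z zl; rewrite (lt_le_trans yu (ul _ zl)) /=.
    by have /andP[] : c < z < d by apply: lcd; rewrite inE zl orbT.
  - move=> z /andP[yz zd] zc; have := all_cross z.
    rewrite zd andbT => /(_ _ zc); rewrite (le_trans _ yz) ?(le_trans (ltW cs)) ?(ltW sy)// => /(_ isT).
    by rewrite inE => /predU1P[zs|//]; move: yz; rewrite zs leNgt sy.
  - by move=> z zl; apply: jump; rewrite inE zl orbT.
by rewrite big_cons -yd -xy cx; ring.
Qed.

(** On either side of a crossing the sine is nonzero, whereas cosine -1 forces sine 0; at any other
    point continuity of the cosine suffices. *)
Lemma crossing_isolated c : (forall s, cos (th s) = -1 -> crossing 1 s \/ crossing (-1) s) ->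
  exists2 d : R, 0 < d & forall x, `|x - c| < d -> cos (th x) = -1 -> x = c.
Proof.
move=> all_cross.
have sin_cross (e : R) s : crossing e s -> exists2 d : R, 0 < d &
    forall x, `|x - s| < d -> cos (th x) = -1 -> x = s.
  move=> [_ [d d0 hd]]; exists d => // x; rewrite ltr_norml => /andP[x1 x2] xc.
  have sx : sin (th x) = 0 by apply: cos1sin0; rewrite xc normrN normr1.
  have [h1 h2] := hd x.
  case: (ltgtP x s) => // xs.
  - by have := h1 ltac:(lra); rewrite sx mulr0 ltxx.
  - by have := h2 ltac:(lra); rewrite sx mulr0 ltxx.
have [/all_cross[|]|cN] := pselect (cos (th c) = -1); [exact: sin_cross|exact: sin_cross|].
have cc : continuous (cos \o th).
  by move=> x; apply: continuous_comp; [exact: th_cont|exact: continuous_cos].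
have e0 : 0 < `|cos (th c) + 1| by rewrite normr_gt0 addr_eq0; apply/eqP.
have /(_ c) /cvgrPdist_lt /(_ _ e0) := cc.
move=> /nbhs_ballP [d d0 hd]; exists d => // x xs xc.
have := hd x; rewrite /ball /= distrC => /(_ xs).
by rewrite xc opprK ltxx.
Qed.

End CrossingCount.

Section WindingNumber.
Context {R : realType}.

(** Sheets are half-open, hence symmetric under negation except for their end points, which are
    excluded by the condition on the cosine. *)
Lemma sheetN (t : R) : cos t != -1 -> sheet (- t) = - sheet t.
Proof.
move=> ct; apply: sheet_eq; have /andP[h1 h2] := sheet_itv t.
have h3 : t != 2 * pi * (sheet t)%:~R - pi.
  by apply: contraNneq ct => ->; rewrite cos_sheet.
have : 2 * pi * (sheet t)%:~R - pi < t by rewrite lt_neqAle eq_sym h3.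
by rewrite mulrNz mulrN; lra.
Qed.

(** Reduction to the counterclockwise case for -[th]; the sine does not vanish at x and y, so
    [sheetN] applies there. *)
Lemma sheet_crossing_cw (th : R -> R) s : continuous th -> crossing th (-1) s ->
  exists2 d : R, 0 < d & forall x y, s - d < x < s -> s < y < s + d ->
    sheet (th y) - sheet (th x) = -1.
Proof.
move=> cth [cs [d d0 hd]].
have cN : continuous (fun x => - th x) by move=> x; exact: (cvgN (cth x)).
have [] := @sheet_crossing_ccw R (fun x => - th x) cN s.
  split; first by rewrite cosN.
  by exists d => // x; have := hd x; rewrite sinN mul1r mulN1r.
move=> d' d'0 hd'; exists (Num.min d d'); first by rewrite lt_min d0.
have m1 : Num.min d d' <= d by rewrite ge_min lexx.
have m2 : Num.min d d' <= d' by rewrite ge_min lexx orbT.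
move=> x y sx sy.
have nc z : sin (th z) != 0 -> cos (th z) != -1.
  by apply: contra_neq => zc; apply: cos1sin0; rewrite zc normrN normr1.
have [h1 _] := hd x; have [_ h2] := hd y.
have := hd' x y ltac:(lra) ltac:(lra).
rewrite !sheetN.
- by rewrite -opprB opprK => e; rewrite -e; ring.
- by apply: nc; have := h1 ltac:(lra); rewrite mulN1r oppr_gt0 => /lt_eqF ->.
- by apply: nc; have := h2 ltac:(lra); rewrite mulN1r oppr_lt0 => /gt_eqF ->.
Qed.

(** Compactness in the form of [locally_constant_right]: close to c, moving the right end adds at
    most the point c, so finiteness on [a, d] propagates in d. *)
Lemma finite_isolated (S : set R) (a b : R) : a <= b ->
  (forall c, a <= c <= b -> exists2 d : R, 0 < d & forall x, `|x - c| < d -> S x -> x = c) ->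
  finite_set (S `&` [set x | a <= x <= b]).
Proof.
move=> ab iso.
apply: (@locally_constant_right _ (fun d => finite_set (S `&` [set x | a <= x <= d])) _ _ ab).
- move=> c /iso[d d0 hd]; exists d => // x y axb ayb xc yc finx.
  apply: (@sub_finite_set _ _ ((S `&` [set z | a <= z <= x]) `|` [set c])).
    move=> z [Sz /andP[az zy]] /=.
    have [zx|xz] := leP z x; first by left; split => //; apply/andP.
    by right; apply: hd => //; move: xc yc; rewrite !ltr_norml; lra.
  by rewrite finite_setU; split.
- apply: (@sub_finite_set _ _ [set a]) => // z [_ /andP[az za]] /=.
  by apply/le_anti; rewrite az za.
Qed.

Lemma card_seq_set (l : seq R) : uniq l -> [set` l] #= `I_(size l).
Proof.
move=> ul; have /finite_setP[n An] := finite_seq l.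
have := card_fset_set An.
have -> : fset_set [set` l] = finmap.seq_fset tt l.
  apply/finmap.fsetP => x; rewrite in_fset_set; last exact: finite_seq.
  rewrite finmap.seq_fsetE; apply/idP/idP => [/set_mem//|xl]; exact: mem_set.
move=> e; suff -> : size l = n by [].
by rewrite -e -{1}(undup_id ul) -(finmap.size_seq_fset tt l).
Qed.

Lemma crossing_count (th : R -> R) (a b : int) (P N : set R) : continuous th ->
  limits_at_infinity th (2 * pi * a%:~R) (2 * pi * b%:~R) ->
  (forall s, cos (th s) = -1 -> P s \/ N s) ->
  (forall s, P s -> crossing th 1 s) ->
  (forall s, N s -> crossing th (-1) s) ->
  exists p n : nat, [/\ P #= `I_p, N #= `I_n & p%:Z - n%:Z = b - a].
Proof.
move=> cth lim all_PN crP crN.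
have pi0 := @pi_gt0 R.
have disj s : P s -> N s -> False.
  move=> /crP[_ [d d0 hd]] /crN[_ [d' d'0 hd']].
  pose m := Num.min d d'; have m0 : 0 < m by rewrite lt_min d0.
  have m1 : m <= d by rewrite ge_min lexx.
  have m2 : m <= d' by rewrite ge_min lexx orbT.
  have [+ _] := hd (s - m / 2); have [+ _] := hd' (s - m / 2).
  by move=> /(_ ltac:(lra)) + /(_ ltac:(lra)); lra.
(* Within pi/2 of a multiple of 2 pi the argument is interior to a sheet, so all crossings lie
   between -X and X and the sheets at the ends are a and b. *)
have [|X X0 hX] := lim (pi / 2); first by rewrite divr_gt0.
have shl x : x <= - X -> sheet (th x) = a.
  have [h _] := hX x; move=> /h; rewrite ler_norml => /andP[h1 h2].
  by apply: sheet_eq; lra.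
have shr x : X <= x -> sheet (th x) = b.
  have [_ h] := hX x; move=> /h; rewrite ler_norml => /andP[h1 h2].
  by apply: sheet_eq; lra.
have ncl x (m : int) : `|th x - 2 * pi * m%:~R| <= pi / 2 -> cos (th x) <> -1.
  move=> h; have := @cos_gtN1 R (th x + 2 * pi * (- m)%:~R).
  rewrite cosD_int mulrNz mulrN => /(_ _) h' xc; move: h'.
  by rewrite xc ltxx => h'; suff : is_true false by []; apply: h'; apply: le_lt_trans h _; lra.
have cross_in s : cos (th s) = -1 -> - X < s < X.
  move=> sc; have [h1 h2] := hX s; apply/andP; split; rewrite ltNge; apply/negP => h.
  - exact: (ncl _ _ (h1 h)) sc.
  - exact: (ncl _ _ (h2 h)) sc.
have all_cross s : cos (th s) = -1 -> crossing th 1 s \/ crossing th (-1) s.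
  by move=> /all_PN[/crP|/crN]; [left|right].
have XX : - X <= X by lra.
have := @finite_isolated [set x | cos (th x) = -1] _ _ XX _.
move=> /(_ (fun c _ => crossing_isolated cth c all_cross)) /finite_seqP[l0 el0].
have l0P x : x \in l0 <-> cos (th x) = -1.
  have -> : x \in l0 <-> [set` l0] x by [].
  rewrite -el0 /=; split=> [[]//|xc]; split => //.
  by have /andP[/ltW -> /ltW ->] := cross_in _ xc.
pose l := sort <=%R (undup l0).
have lP x : x \in l <-> cos (th x) = -1 by rewrite mem_sort mem_undup.
have sl : sorted <%R l by rewrite /l lt_sorted_uniq_le sort_uniq undup_uniq/= sort_le_sorted.
have ul : uniq l by rewrite sort_uniq undup_uniq.
pose e s : int := if `[< P s >] then 1 else -1.
have lsum : b - a = \sum_(s <- l) e s.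
  rewrite -(shr X (lexx _)) -(shl (- X) (lexx _)).
  apply: sheet_sum => //; first lra.
  - by move=> x /lP; exact: cross_in.
  - by move=> x _ /lP.
  - move=> s /lP /all_PN [Ps|Ns].
    + by rewrite /e asboolT//; apply: sheet_crossing_ccw => //; exact: crP.
    + rewrite /e asboolF; last by move=> Ps; exact: disj Ps Ns.
      by apply: sheet_crossing_cw => //; exact: crN.
have PE : P = [set` [seq s <- l | `[< P s >]]].
  apply/seteqP; split=> s /=; rewrite mem_filter.
    by move=> Ps; rewrite asboolT//=; apply/lP; case: (crP _ Ps).
  by move=> /andP[/asboolP].
have NE : N = [set` [seq s <- l | ~~ `[< P s >]]].
  apply/seteqP; split=> s /=; rewrite mem_filter.
    move=> Ns; rewrite asboolF/=; first by apply/lP; case: (crN _ Ns).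
    by move=> Ps; exact: disj Ps Ns.
  by move=> /andP[/asboolPn nP /lP /all_PN[]].
exists (size [seq s <- l | `[< P s >]]), (size [seq s <- l | ~~ `[< P s >]]); split.
- by rewrite {1}PE; apply: card_seq_set; exact: filter_uniq.
- by rewrite {1}NE; apply: card_seq_set; exact: filter_uniq.
rewrite lsum; elim: (l) => [|s l' ih]; first by rewrite big_nil.
rewrite big_cons -ih /= /e; case: `[< P s >] => /=; lia.
Qed.

End WindingNumber.

(** * Complex differentiability *)

Section ComplexDerivative.
Context {R : realType}.
Implicit Types z w : R[i].

Lemma cplx_near (z : cplx R) (P : cplx R -> Prop) (d : R) : 0 < d ->
  (forall w : cplx R, normc (w - z) < d -> P w) -> \forall w \near z, P w.
Proof.
move=> d0 h; apply/nbhs_ballP; exists (d%:C : cplx R); first by rewrite /= ltcR.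
move=> w; rewrite /ball /= => zw; apply: h.
by rewrite -ltcR normc_subC.
Qed.

Lemma Re_gt0_near (z : cplx R) (P : cplx R -> Prop) : 0 < Re z ->
  (forall w : cplx R, 0 < Re w -> P w) -> \forall w \near z, P w.
Proof.
move=> z0 h; apply: (cplx_near z0) => w wz; apply: h.
have := Re_le_normc (w - z); rewrite Re_add Re_opp.
by have := ler_norm (Re z - Re w); rewrite distrC; lra.
Qed.

Lemma cplx_derivable_shift (c z : cplx R) :
  derivable (fun w : cplx R => w + c : cplx R) z 1.
Proof. by apply: derivableD; [exact: derivable_id | exact: derivable_cst]. Qed.

Lemma cplx_derivable_prod (I : Type) (s : seq I) (F : I -> cplx R -> cplx R)
    (z : cplx R) :
  (forall i, derivable (F i) z 1) ->
  derivable (fun w : cplx R => \prod_(i <- s) F i w : cplx R) z 1.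
Proof.
move=> dF; elim: s => [|i s ih].
  by under eq_fun do rewrite big_nil; exact: derivable_cst.
have -> : (fun w : cplx R => \prod_(j <- i :: s) F j w : cplx R) =
    F i * (fun w : cplx R => \prod_(j <- s) F j w : cplx R).
  by apply/funext => w; rewrite big_cons.
by apply: derivableM; [exact: dF | exact: ih].
Qed.

(** The difference quotient equals q (z + h) exactly, so the Lipschitz bound on q is all that the
    limit requires; the derivative is q z. *)
Lemma derivable_slope (f q : cplx R -> cplx R) (z : cplx R) (L : R) :
  0 < Re z ->
  (forall w : cplx R, 0 < Re w -> f w - f z = (w - z) * q w) ->
  (forall w : cplx R, Re z / 2 <= Re w -> normc (q w - q z) <= L * normc (w - z)) ->
  derivable f z 1.
Proof.
move=> z0 fq lip; apply/cvg_ex; exists (q z).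
have L1 : 0 < `|L| + 1 by rewrite ltr_wpDl.
apply/cvgrPdist_le => /= eps eps0.
(* The norm of [cplx R] is complex-valued, and so is eps; a positive complex number is real. *)
have [e0 epsE] : 0 < Re eps /\ eps = (Re eps)%:C.
  move: eps0; rewrite ltcE /= => /andP[/eqP i0 r0]; split => //.
  exact: complex_ext.
pose d := Num.min (Re z / 2) (Re eps / (`|L| + 1)).
have d0 : 0 < d by rewrite lt_min !divr_gt0.
apply: (@cplx_near 0 _ _ d0) => h; rewrite subr0 => hd h0.
have hz : Re z / 2 <= Re (h + z).
  have := Re_le_normc h; have := ler_norm (- Re h); rewrite normrN Re_add.
  by move: hd; rewrite lt_min => /andP[h1 h2]; lra.
have -> : h *: (1 : cplx R) = h by rewrite /GRing.scale /= mulr1.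
rewrite fq; last by apply: lt_le_trans hz; rewrite divr_gt0.
rewrite addrK /GRing.scale /= mulKf//.
rewrite epsE lecR (normc_subC (q z)).
apply: (le_trans (lip _ hz)); rewrite addrK.
have : normc h <= Re eps / (`|L| + 1).
  by move: hd; rewrite lt_min => /andP[_ /ltW].
rewrite ler_pdivlMr// => hh.
apply: le_trans hh; rewrite mulrC ler_wpM2l ?normc_ge0//.
by rewrite (le_trans (ler_norm _))// lerDl.
Qed.

Lemma deflated_derivable (phi : R -> R) (k : R) (t : seq R[i]) (z : cplx R) :
  continuous phi -> (@lebesgue_measure R).-integrable setT (EFin \o phi) ->
  k != 0 -> {in t, forall m, 0 < Re m} -> 0 < Re z ->
  derivable (deflated phi k t : cplx R -> cplx R) z 1.
Proof.
move=> cphi iphi k0 t0 z0.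
have zt0 : {in z :: t, forall m, 0 < Re m}.
  by move=> m; rewrite inE => /predU1P[->//|]; exact: t0.
have zz0 : z + conjc z != 0.
  by rewrite -normc_gt0 (lt_le_trans _ (Re_le_normc _))// Re_add Re_conj normr_gt0 gt_eqF ?addr_gt0.
(* By [deflated_cons_slope], valid whether or not z is a zero, this is minus the slope between w and
   z. It inherits a Lipschitz bound from the two functions, so no second-order kernel has to be
   estimated. *)
pose q (w : R[i]) : R[i] := - (deflated phi k t w - deflated phi k (z :: t) w) / (z + conjc z).
pose e := Re z / 2.
have e0 : 0 < e by rewrite divr_gt0.
have ez : e <= Re z by rewrite /e; lra.
pose K := 2 * (e^-1 * e^-1 * L1norm phi) / `|k|.
apply: (@derivable_slope _ q _ (2 * K / normc (z + conjc z))) => // w.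
- move=> w0; rewrite (deflatedB k cphi iphi)// /q (deflated_cons_slope k cphi iphi)//.
  by field.
- move=> zw.
  have -> : q w - q z = ((deflated phi k (z :: t) w - deflated phi k (z :: t) z) -
     (deflated phi k t w - deflated phi k t z)) / (z + conjc z) by rewrite /q; ring.
  rewrite normcM normcV [leRHS]mulrAC ler_wpM2r ?invr_ge0 ?normc_ge0//.
  apply: (le_trans (normcB _ _)).
  have h1 := deflated_lipschitz k cphi iphi zt0 e0 zw ez.
  have h2 := deflated_lipschitz k cphi iphi t0 e0 zw ez.
  by move: h1 h2; rewrite -/K; lra.
Qed.

End ComplexDerivative.

(** * Zeros in the right half-plane *)

Section UniformContinuity.
Context {R : realType}.
Implicit Types g : R -> R[i].

Lemma ccontinuousP g : (forall x eta : R, 0 < eta -> exists2 d : R, 0 < d &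
    forall y, `|y - x| < d -> normc (g y - g x) <= eta) -> ccontinuous g.
Proof.
move=> h; split=> x; apply/cvgrPdist_le => eta eta0;
  have [d d0 hd] := h x _ eta0; apply/nbhs_ballP; exists d => // y;
  rewrite /ball /= distrC => /hd yx; apply: le_trans yx;
  rewrite normc_subC.
- by rewrite -Re_opp -Re_add Re_le_normc.
- by rewrite -Im_opp -Im_add Im_le_normc.
Qed.

Lemma ccontinuous_normcP g (x eta : R) : ccontinuous g -> 0 < eta -> exists2 d : R, 0 < d &
  forall y, `|y - x| < d -> normc (g y - g x) <= eta.
Proof.
move=> [c1 c2] eta0; have e0 : 0 < eta / 2 by rewrite divr_gt0.
have /(_ x) /cvgrPdist_le /(_ _ e0) /nbhs_ballP [d1 d10 h1] := c1.
have /(_ x) /cvgrPdist_le /(_ _ e0) /nbhs_ballP [d2 d20 h2] := c2.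
exists (Num.min d1 d2); first by rewrite lt_min; apply/andP.
move=> y; rewrite lt_min => /andP[y1 y2].
have := h1 y; rewrite /ball /= distrC => /(_ y1) i1.
have := h2 y; rewrite /ball /= distrC => /(_ y2) i2.
rewrite normc_subC (le_trans (normc_le_ReIm _))// Re_add Im_add Re_opp Im_opp.
by lra.
Qed.

Lemma ccontinuous_uniform_limit g : (forall eta : R, 0 < eta -> exists2 h : R -> R[i],
    ccontinuous h & forall x, normc (h x - g x) <= eta) -> ccontinuous g.
Proof.
move=> lim; apply: ccontinuousP => x eta eta0.
have e0 : 0 < eta / 3 by rewrite divr_gt0.
have [h ch hg] := lim _ e0.
have [d d0 hd] := ccontinuous_normcP x ch e0.
exists d => // y /hd yx.
have -> : g y - g x = (h y - h x) - (h y - g y) + (h x - g x) by ring.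
apply: (le_trans (normcD _ _)); have := normcB (h y - h x) (h y - g y).
by have := hg x; have := hg y; lra.
Qed.

End UniformContinuity.

Section Winding.
Context {R : realType} (phi : R -> R) (k M B : R).
Hypotheses (phi_cont : continuous phi)
  (phi_int : (@lebesgue_measure R).-integrable setT (EFin \o phi)) (k0 : k != 0)
  (phi_lip : forall x y, `|phi x - phi y| <= M * `|x - y|)
  (phi_bnd : forall x, `|phi x| <= B)
  (bv_neq0 : forall s, phi s = 0 -> boundary_value phi k s != 0).
Implicit Types (t : seq R[i]) (l m : R[i]).
Local Notation curve := (boundary_curve phi k).
Local Notation D := (deflated phi k).
Local Notation line := (vline k).

Lemma Re_boundary_curve s : phi s = 0 -> Re (curve s) = boundary_value phi k s.
Proof.
move=> s0; rewrite /boundary_curve /boundary_value /=; congr (1 - _ * _).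
by apply: eq_Rintegral => v _; rewrite s0 mulr0 subr0.
Qed.

Lemma Im_boundary_curve s : Im (curve s) = - (Num.sg k * pi * phi s / k ^+ 2).
Proof. by []. Qed.

Lemma boundary_curve_neq0 s : curve s != 0.
Proof.
apply/eqP => c0; have i0 := Im_boundary_curve s; rewrite c0 /= in i0.
have s0 : phi s = 0.
  apply/eqP; move/eqP: i0; rewrite eq_sym oppr_eq0 !mulf_eq0 invr_eq0 expf_eq0 /= (negPf k0).
  by rewrite sgr_eq0 (negPf k0) (gt_eqF (pi_gt0 R)) /= orbF.
by have /eqP := bv_neq0 s0; rewrite -(Re_boundary_curve s0) c0.
Qed.

Lemma vline_Re_Im l : line (Re l) (- Im l / k) = l.
Proof. by apply: complex_ext => //=; field. Qed.

Lemma normc_vlineB rho x y : normc (line rho x - line rho y) = `|k| * `|x - y|.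
Proof.
rewrite -normrM; have -> : line rho x - line rho y = 'i * (k * (y - x))%:C.
  by apply: complex_ext => /=; ring.
by rewrite normcM normc_i mul1r normc_real !normrM distrC.
Qed.

Lemma normc_vlineBl rho rho' x : normc (line rho x - line rho' x) = `|rho - rho'|.
Proof.
have -> : line rho x - line rho' x = (rho - rho')%:C.
  by apply: complex_ext => /=; ring.
exact: normc_real.
Qed.

Lemma ccontinuous_deflated t rho : {in t, forall m, 0 < Re m} -> 0 < rho ->
  ccontinuous (fun x => D t (line rho x)).
Proof.
move=> t0 rho0; apply: ccontinuousP => x eta eta0.
pose K := 2 * (rho^-1 * rho^-1 * L1norm phi) / `|k| * `|k|.
have K0 : 0 <= K.
  by rewrite /K !(mulr_ge0, divr_ge0, invr_ge0)// ?L1norm_ge0// ?invr_ge0// ltW.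
have K1 : 0 < K + 1 by rewrite ltr_wpDl.
exists (eta / (K + 1)) => [|y yx]; first by rewrite divr_gt0.
have := deflated_lipschitz k phi_cont phi_int t0 rho0
  (lexx rho : rho <= Re (line rho y)) (lexx rho : rho <= Re (line rho x)).
move=> /le_trans; apply; rewrite normc_vlineB.
have -> : 2 * (rho^-1 * rho^-1 * L1norm phi) / `|k| * (`|k| * `|y - x|) = K * `|y - x|.
  by rewrite /K; ring.
apply: (@le_trans _ _ ((K + 1) * `|y - x|)); first by rewrite ler_wpM2r// lerDl.
by move: yx; rewrite ltr_pdivlMr// mulrC => /ltW.
Qed.

Lemma tends_to_1_deflated t rho : {in t, forall m, 0 < Re m} -> 0 < rho ->
  tends_to_1 (fun x => D t (line rho x)).
Proof.
move=> t0 rho0 eta eta0.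
have [X X0 hX] := deflated_tail phi_cont phi_int k0 t0 rho0 eta0.
have nk0 : 0 < `|k| by rewrite normr_gt0.
exists (X / `|k|) => [|x]; first by rewrite divr_gt0.
rewrite ler_pdivrMr// => xX; apply: hX => //=.
by rewrite normrN normrM mulrC.
Qed.

Lemma ccontinuous_boundary_curve : ccontinuous curve.
Proof.
apply: ccontinuous_uniform_limit => eta eta0.
have [r r0 hr] := boundary_limit phi_cont phi_int k0 phi_lip phi_bnd eta0.
exists (fun x => D [::] (line r x)); last by move=> x; exact: hr.
exact: ccontinuous_deflated.
Qed.

Lemma tends_to_1_boundary_curve : tends_to_1 curve.
Proof.
move=> eta eta0; have e0 : 0 < eta / 2 by rewrite divr_gt0.
have [r r0 hr] := boundary_limit phi_cont phi_int k0 phi_lip phi_bnd e0.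
have nil0 : {in [::], forall m : R[i], 0 < Re m} by [].
have [X X0 hX] := tends_to_1_deflated nil0 r0 e0.
exists X => // x /hX h1; have h2 := hr r x r0 (lexx _).
have -> : curve x - 1 = (D [::] (line r x) - 1) - (D [::] (line r x) - curve x).
  by ring.
by apply: (le_trans (normcB _ _)); lra.
Qed.

Lemma deflated_far : exists2 Y : R, 0 < Y & forall t l,
  {in t, forall m, 0 < Re m} -> Y <= Re l -> normc (D t l - 1) <= 1 / 2.
Proof.
have nk0 : 0 < `|k| by rewrite normr_gt0.
(* Makes the bound of [deflated_near1] at most 1/2, for all t at once; the 1 ensures Y > 0. *)
pose Y := 4 * L1norm phi / `|k| + 1.
have Y0 : 0 < Y by rewrite ltr_wpDl// divr_ge0// mulr_ge0// L1norm_ge0.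
exists Y => // t l t0 Yl.
apply: (le_trans (deflated_near1 k phi_cont phi_int t0 Y0 Yl)).
have -> : 2 * (Y^-1 * L1norm phi) / `|k| = 2 * L1norm phi / `|k| / Y by ring.
rewrite ler_pdivrMr// /Y.
have -> : 4 * L1norm phi / `|k| = 2 * (2 * L1norm phi / `|k|) by ring.
by lra.
Qed.

(* All zeros lie in a fixed compact rectangle, hence at the point Y of the real axis
   each Blaschke factor has modulus at most sqrt q < 1; on the other hand
   |deflated t Y| <= 3/2 for every t, while |Delta Y| >= 1/2. *)
Lemma chain_bounded : exists n : nat, forall t, zero_chain phi k t -> (size t < n)%N.
Proof.
have nk0 : 0 < `|k| by rewrite normr_gt0.
have nil0 : {in [::], forall m : R[i], 0 < Re m} by [].
have [m0 m00 hm] := normc_lower_bound ccontinuous_boundary_curve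
  tends_to_1_boundary_curve boundary_curve_neq0.
have m20 : 0 < m0 / 2 by rewrite divr_gt0.
have [r r0 hr] := boundary_limit phi_cont phi_int k0 phi_lip phi_bnd m20.
have zero_r l : 0 < Re l -> D [::] l = 0 -> r < Re l.
  move=> l0 Dl; rewrite ltNge; apply/negP => lr.
  have := hr _ (- Im l / k) l0 lr; rewrite vline_Re_Im Dl sub0r normc_opp.
  by have := hm (- Im l / k); lra.
have [X X0 hX] := deflated_tail phi_cont phi_int k0 nil0 r0 (divr_gt0 ltr01 (ltr0Sn R 1)).
have zero_X l : 0 < Re l -> D [::] l = 0 -> `|Im l| < X.
  move=> l0 Dl; rewrite ltNge; apply/negP => lX.
  have := hX _ (ltW (zero_r _ l0 Dl)) lX; rewrite Dl sub0r normc_opp normc1; lra.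
have [Y Y0 hY] := deflated_far.
have zero_Y l : 0 < Re l -> D [::] l = 0 -> Re l < Y.
  move=> l0 Dl; rewrite ltNge; apply/negP => lY.
  by have := hY _ _ nil0 lY; rewrite Dl sub0r normc_opp normc1; lra.
pose r' := Num.min r Y.
have r'0 : 0 < r' by rewrite lt_min r0.
have r'r : r' <= r by rewrite ge_min lexx.
have r'Y : r' <= Y by rewrite ge_min lexx orbT.
(* From |Y + conjc m|^2 - |Y - m|^2 = 4 Y Re m, where Re m > r' and |Y + conjc m|^2 <= (2Y)^2 + X^2
   for every zero m. Taking r' <= Y ensures q >= 0. *)
pose q := 1 - 4 * Y * r' / ((2 * Y) ^+ 2 + X ^+ 2).
have den0 : 0 < (2 * Y) ^+ 2 + X ^+ 2 by rewrite addr_gt0// exprn_gt0// mulr_gt0.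
have q1 : q < 1 by rewrite /q ltrBlDr ltrDl divr_gt0// !mulr_gt0.
have q0 : 0 <= q.
  rewrite /q subr_ge0 ler_pdivrMr// mul1r.
  have : 4 * Y * r' <= 4 * Y * Y by rewrite ler_wpM2l// mulr_ge0// ltW.
  have := sqr_ge0 X; have -> : (2 * Y) ^+ 2 = 4 * Y * Y by ring.
  lra.
pose l0 : R[i] := Y%:C.
have factor m : 0 < Re m -> D [::] m = 0 ->
    normc (l0 - m) ^+ 2 <= q * normc (l0 + conjc m) ^+ 2.
  move=> m_gt0 Dm; have hr' := zero_r _ m_gt0 Dm; have hX' := zero_X _ m_gt0 Dm.
  have hY' := zero_Y _ m_gt0 Dm.
  rewrite !sqr_normc !Re_add !Im_add Re_opp Im_opp Re_conj Im_conj /=.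
  move: (Re m) (Im m) m_gt0 hr' hX' hY' => a b a0 ra bX aY.
  have b2 : b ^+ 2 <= X ^+ 2.
    by rewrite -real_normK ?num_real// ler_pXn2r ?nnegrE// ltW.
  have d2 : (Y + a) ^+ 2 + b ^+ 2 <= (2 * Y) ^+ 2 + X ^+ 2.
    by rewrite lerD// ler_pXn2r ?nnegrE//; lra.
  have h : 4 * Y * r' / ((2 * Y) ^+ 2 + X ^+ 2) * ((Y + a) ^+ 2 + b ^+ 2) <= 4 * Y * a.
    rewrite mulrAC ler_pdivrMr//; apply: ler_pM => //.
    - by rewrite !mulr_ge0// ltW.
    - by rewrite addr_ge0// sqr_ge0.
    - by rewrite ler_wpM2l// ?mulr_ge0// ?ltW// (le_lt_trans r'r).
  rewrite !sub0r sqrrN /q mulrBl mul1r lerBrDl (le_trans (lerD h (lexx _)))//.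
  by rewrite le_eqVlt; apply/orP; left; apply/eqP; ring.
(* Here 1/9 is the quotient of (1/2)^2 and (3/2)^2, the bounds for the squared moduli of Delta and
   of its quotient at Y. *)
have bound t : zero_chain phi k t -> 1 / 9 <= q ^+ size t.
  move=> ct; have t0 := zero_chain_gt0 ct.
  have l00 : Y <= Re l0 by [].
  have /(congr1 (fun z => normc z ^+ 2)) := deflated_chain phi_cont phi_int ct (Y0 : 0 < Re l0).
  rewrite !normcM !exprMn => e.
  have h1 := hY _ _ t0 l00; have h2 := hY _ _ nil0 l00.
  have n1 : normc (D t l0) ^+ 2 <= 9 / 4.
    have := normcD (D t l0 - 1) 1; rewrite subrK normc1 => h3.
    have -> : 9 / 4 = (3 / 2) ^+ 2 :> R by field.
    by rewrite ler_pXn2r ?nnegrE ?normc_ge0//; lra.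
  have n2 : 1 / 4 <= normc (D [::] l0) ^+ 2.
    have := lerB_normc 1 (1 - D [::] l0).
    rewrite (_ : 1 - (1 - D [::] l0) = D [::] l0); last by ring.
    rewrite normc1 (normc_subC 1) => h3.
    have -> : 1 / 4 = (1 / 2) ^+ 2 :> R by field.
    by rewrite ler_pXn2r ?nnegrE ?normc_ge0//; lra.
  pose P1 := normc (\prod_(m <- t) (l0 - m)) ^+ 2.
  pose P2 := normc (\prod_(m <- t) (l0 + conjc m)) ^+ 2.
  have P12 : P1 <= q ^+ size t * P2.
    have : {in t, forall m, 0 < Re m /\ D [::] m = 0}.
      move=> m mt; split; first exact: t0.
      exact: (zero_chain_root phi_cont phi_int ct mt).
    rewrite /P1 /P2; elim: (t) => [_|m s ih hs].
      by rewrite !big_nil expr0 mul1r.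
    rewrite !big_cons !normcM !exprMn.
    have -> : q ^+ size (m :: s) = q * q ^+ size s by rewrite -exprS.
    rewrite [leRHS]mulrACA.
    have [m_gt0 Dm] := hs m (mem_head _ _).
    apply: ler_pM; rewrite ?sqr_ge0//; first exact: factor.
    by apply: ih => m' m's; apply: hs; rewrite inE m's orbT.
  have P20 : 0 < P2.
    rewrite exprn_gt0// normc_gt0 prodf_seq_neq0; apply/allP => m mt /=.
    rewrite -normc_gt0 (lt_le_trans _ (Re_le_normc _))// Re_add Re_conj.
    by rewrite normr_gt0 gt_eqF// addr_gt0// t0.
  rewrite -(ler_pM2r P20).
  have : 1 / 4 * P2 <= 9 / 4 * (q ^+ size t * P2).
    apply: (@le_trans _ _ (normc (D [::] l0) ^+ 2 * P2)); first by rewrite ler_wpM2r// ltW.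
    rewrite -e; apply: (@le_trans _ _ (9 / 4 * P1)); first by rewrite ler_wpM2r// sqr_ge0.
    by rewrite ler_wpM2l.
  lra.
have qn : (fun n => q ^+ n) @ \oo --> (0 : R) by apply: cvg_expr; rewrite ger0_norm.
have /cvgrPdist_lt /(_ (1 / 9)) := qn.
rewrite divr_gt0// => /(_ isT) [n _ hn].
exists n => t ct; rewrite ltnNge; apply/negP => nt.
have := hn _ nt; rewrite /= sub0r normrN ger0_norm ?exprn_ge0// ltNge.
by rewrite bound.
Qed.

Lemma maximal_chain : exists2 t, zero_chain phi k t &
  forall l, 0 < Re l -> D t l != 0.
Proof.
have [n hn] := chain_bounded.
apply: contrapT => nomax.
suff [t ct nt] : exists2 t, zero_chain phi k t & size t = n by have := hn _ ct; rewrite nt ltnn.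
elim: (n) => [|i [t ct ti]]; first by exists [::].
have [l [l0 Dl]] : exists l, 0 < Re l /\ D t l = 0.
  apply: contrapT => nol; apply: nomax; exists t => // l l0.
  by apply/eqP => Dl; apply: nol; exists l.
by exists (l :: t); rewrite /= ?ti.
Qed.

End Winding.

Section RootCount.
Context {R : realType} (phi : R -> R) (k M B : R).
Hypotheses (phi_cont : continuous phi)
  (phi_int : (@lebesgue_measure R).-integrable setT (EFin \o phi)) (k0 : k != 0)
  (phi_lip : forall x y, `|phi x - phi y| <= M * `|x - y|)
  (phi_bnd : forall x, `|phi x| <= B)
  (bv_neq0 : forall s, phi s = 0 -> boundary_value phi k s != 0).
Implicit Types (t : seq R[i]) (l m : R[i]).
Local Notation curve := (boundary_curve phi k).
Local Notation D := (deflated phi k).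
Local Notation line := (vline k).
Local Notation sk := (Num.sg k).

Lemma has_lift_deflated t (rho : R) : {in t, forall m, 0 < Re m} ->
  (forall l, 0 < Re l -> D t l != 0) -> 0 < rho ->
  has_lift (fun x => D t (line rho x)) 0 0.
Proof.
move=> t0 Dt; apply: (@has_lift_homotopy _ (fun rho x => D t (line rho x))).
- by move=> r r0; exact: ccontinuous_deflated.
- by move=> r r0; exact: tends_to_1_deflated.
- by move=> r r0 x; exact: Dt.
- move=> e e0; exists (2 * (e^-1 * e^-1 * L1norm phi) / `|k|).
    by rewrite !(mulr_ge0, divr_ge0, invr_ge0)// ?L1norm_ge0// ?invr_ge0// ltW.
  move=> r r' x er er'; rewrite -(normc_vlineBl k r r' x).
  exact: deflated_lipschitz.
- have [Y Y0 hY] := deflated_far phi_cont phi_int k0.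
  exists Y => // r x Yr.
  by have := hY t (line r x) t0 Yr; lra.
Qed.

(** As the line passes to the left of m, numerator and denominator are minus a curve, respectively
    the conjugate of a curve, of the form treated by [has_lift_affine]. Each contributes a half
    turn, in total 2 pi times the sign of k. *)
Lemma has_lift_blaschke_factor m (rho : R) : 0 < rho -> rho < Re m ->
  has_lift (fun x => (line rho x - m) / (line rho x + conjc m))
    (pi - sk * pi) (pi + sk * pi).
Proof.
move=> rho0 rm.
have a1 : 0 < Re m - rho by lra.
have a2 : 0 < Re m + rho by lra.
have h1 := has_liftM (has_lift_cst pi ltr01) (has_lift_affine (Im m) k0 a1).
have h2 := has_lift_inv (has_lift_conj (has_lift_affine (Im m) k0 a2)).
have := has_liftM h1 h2.
have -> : pi - sk * (pi / 2) - - - (sk * (pi / 2)) = pi - sk * pi by field.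
have -> : pi + sk * (pi / 2) + - - (sk * (pi / 2)) = pi + sk * pi by field.
apply: eq_has_lift => x; congr (_ * _^-1).
- by rewrite cospi sinpi; case: (m) => a b; apply: complex_ext => /=; ring.
- by case: (m) => a b; apply: complex_ext => /=; ring.
Qed.

Lemma has_lift_blaschke_product t (rho : R) : 0 < rho ->
  {in t, forall m, rho < Re m} ->
  has_lift (fun x => \prod_(m <- t) ((line rho x - m) / (line rho x + conjc m)))
    ((size t)%:R * (pi - sk * pi)) ((size t)%:R * (pi + sk * pi)).
Proof.
move=> rho0; elim: t => [_|m t ih ht].
  rewrite !mul0r; have := @has_lift_cst R 1 0 ltr01.
  apply: eq_has_lift => x; rewrite big_nil cos0 sin0.
  by apply: complex_ext => /=; ring.
rewrite /= -natr1 !mulrDl !mul1r ![(size t)%:R * _ + _]addrC.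
have h1 := has_lift_blaschke_factor rho0 (ht m (mem_head _ _)).
have h2 := ih (fun m' m't => ht m' ltac:(by rewrite inE m't orbT)).
by apply: eq_has_lift (has_liftM h1 h2) => x; rewrite big_cons.
Qed.

Lemma has_lift_boundary_curve t : zero_chain phi k t ->
  (forall l, 0 < Re l -> D t l != 0) ->
  has_lift curve ((size t)%:R * (pi - sk * pi)) ((size t)%:R * (pi + sk * pi)).
Proof.
move=> ct Dt; have t0 := zero_chain_gt0 ct.
have nil0 : {in [::], forall m : R[i], 0 < Re m} by [].
have cc := ccontinuous_boundary_curve phi_cont phi_int k0 phi_lip phi_bnd.
have c1 := tends_to_1_boundary_curve phi_cont phi_int k0 phi_lip phi_bnd.
have [m0 m00 hm] := normc_lower_bound cc c1 (boundary_curve_neq0 k0 bv_neq0).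
(* Up to abscissa r, Delta is within m0/4 of a curve of modulus at least m0. Hence all roots lie to
   the right of r, and |Delta| >= 3 m0/4 on that line exceeds its distance to the curve, as
   [has_lift_close] demands. *)
have m40 : 0 < m0 / 4 by rewrite divr_gt0.
have [r r0 hr] := boundary_limit phi_cont phi_int k0 phi_lip phi_bnd m40.
have tr : {in t, forall m, r < Re m}.
  move=> m mt; rewrite ltNge; apply/negP => mr.
  have := hr _ (- Im m / k) (t0 m mt) mr; rewrite vline_Re_Im//.
  rewrite (zero_chain_root phi_cont phi_int ct mt) sub0r normc_opp.
  by have := hm (- Im m / k); lra.
have lD : has_lift (fun x => D [::] (line r x))
    ((size t)%:R * (pi - sk * pi)) ((size t)%:R * (pi + sk * pi)).
  have := has_liftM (has_lift_deflated t0 Dt r0) (has_lift_blaschke_product r0 tr).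
  rewrite !add0r; apply: eq_has_lift => x.
  have := deflated_chain phi_cont phi_int ct (r0 : 0 < Re (line r x)).
  rewrite big_split /= prodfV mulrA => ->; rewrite mulfK//.
  rewrite prodf_seq_neq0; apply/allP => m mt /=.
  rewrite -normc_gt0 (lt_le_trans _ (Re_le_normc _))// Re_add Re_conj.
  by rewrite normr_gt0 gt_eqF// addr_gt0// t0.
apply: has_lift_close lD => //.
- exact: ccontinuous_deflated.
- exact: tends_to_1_deflated.
- move=> x; have := hr r x r0 (lexx _); rewrite normc_subC => h.
  have := lerB_normc (curve x) (curve x - D [::] (line r x)).
  rewrite (_ : curve x - (curve x - D [::] (line r x)) = D [::] (line r x)); last by ring.
  by have := hm x; lra.
Qed.

(** The final quotient and the denominators do not vanish, so Delta has the zeros of the polynomial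
    with roots t, each of order its number of occurrences in t. *)
Lemma zero_count t : zero_chain phi k t -> (forall l, 0 < Re l -> D t l != 0) ->
  count_with_multiplicity (Delta phi k)
    (Lambda phi k `&` @right_half_plane R) (size t).
Proof.
move=> ct Dt; have t0 := zero_chain_gt0 ct.
have DeltaE l : Delta phi k l = D [::] l.
  rewrite /Delta (negPf k0).
  transitivity (1 + 1 / ('i * k%:C) * cint (fun v => (phi v)%:C / kern k l v)) => //.
  rewrite /deflated; congr (1 + _ * _).
  by apply: eq_cint => v; rewrite /blaschke big_nil mul1r.
have den0 l : 0 < Re l -> \prod_(m <- t) (l + conjc m) != 0.
  move=> l0; rewrite prodf_seq_neq0; apply/allP => m mt /=.
  rewrite -normc_gt0 (lt_le_trans _ (Re_le_normc _))// Re_add Re_conj.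
  by rewrite normr_gt0 gt_eqF// addr_gt0// t0.
have factorE l : 0 < Re l ->
    D [::] l = \prod_(m <- t) (l - m) * (D t l / \prod_(m <- t) (l + conjc m)).
  move=> l0; have := deflated_chain phi_cont phi_int ct l0 => e.
  by rewrite mulrA [_ * D t l]mulrC e mulfK// den0.
exists (undup t), (fun z : R[i] => count_mem z t); split.
- exact: undup_uniq.
- apply/seteqP; split=> z /=.
  + move=> [[_]]; rewrite DeltaE => Dz z0; rewrite mem_undup.
    have := factorE _ z0; rewrite Dz => /esym/eqP.
    rewrite mulf_eq0 (negPf (mulf_neq0 (Dt _ z0) (invr_neq0 (den0 _ z0)))) orbF.
    rewrite prodf_seq_eq0 => /hasP[m mt /=].
    by rewrite subr_eq0 => /eqP ->.
  + rewrite mem_undup => zt; have z0 := t0 _ zt; split => //; split.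
      by rewrite gt_eqF.
    by rewrite DeltaE (zero_chain_root phi_cont phi_int ct zt).
- move=> z; rewrite mem_undup => zt; have z0 := t0 _ zt.
  exists (fun w => \prod_(m <- [seq m <- t | m != z]) (w - m) *
     (D t w / \prod_(m <- t) (w + conjc m))); split.
  + apply: (Re_gt0_near z0) => w w0.
    have d1 (c : R[i] -> R[i]) (u : seq R[i]) : derivable
        (fun w : cplx R => \prod_(m <- u) (w + c m) : cplx R) w 1.
      by apply: cplx_derivable_prod => m; exact: cplx_derivable_shift.
    have d2 : derivable (fun w : cplx R => (\prod_(m <- t) (w + conjc m) : cplx R)^-1) w 1.
      by apply: derivableV; [exact: den0 | exact: d1].
    have d3 := deflated_derivable phi_cont phi_int k0 t0 w0.
    exact: (derivableM (d1 -%R [seq m <- t | m != z]) (derivableM d3 d2)).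
  + rewrite mulf_neq0//; last by rewrite mulf_neq0 ?Dt// invr_neq0// den0.
    rewrite prodf_seq_neq0; apply/allP => m; rewrite mem_filter => /andP[mz _] /=.
    by rewrite subr_eq0 eq_sym.
  + apply: (Re_gt0_near z0) => w w0; rewrite DeltaE factorE//.
    have -> : \prod_(m <- t) (w - m) =
        (w - z) ^+ count_mem z t * \prod_(m <- [seq m <- t | m != z]) (w - m).
      rewrite (bigID (pred1 z)) /= big_filter; congr (_ * _).
      rewrite (eq_bigr (fun=> w - z)) => [|m /eqP ->//].
      by rewrite big_const_seq iter_mulr_1.
    exact: (esym (mulrA _ _ _)).
- rewrite -sum1_size -big_undup_iterop_count; apply: eq_bigr => z _.
  by rewrite Monoid.iteropE iter_addn_0 mul1n.
Qed.

End RootCount.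

(** * Lipschitz bound, boundedness and simple zeros of phi *)

Section RealFunctions.
Context {R : realType} (phi : R -> R).
Hypothesis phi_diff : forall v : R, derivable phi v 1.

Lemma derivable_continuous : continuous phi.
Proof. by move=> v; apply/differentiable_continuous/derivable1_diffP. Qed.

Lemma bounded_derive_lipschitz (M : R) : (forall v : R, `|derive1 phi v| <= M) ->
  forall x y, `|phi x - phi y| <= M * `|x - y|.
Proof.
move=> hM x y; wlog xy : x y / y < x.
  move=> h; case: (ltgtP x y) => [xy|/h//|->]; last by rewrite !subrr normr0 mulr0.
  by rewrite distrC [`|x - y|]distrC h.
have cw : {within `[y, x], continuous phi}.
  by apply: continuous_subspaceT; exact: derivable_continuous.
have dw z : z \in `]y, x[ -> is_derive z 1 phi (derive1 phi z).
  by move=> _; apply: DeriveDef => //; rewrite derive1E.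
have [c _ ->] := MVT xy dw cw.
by rewrite normrM ler_wpM2r.
Qed.

Lemma bounded_of_limits : phi v @[v --> +oo] --> (0 : R) ->
  phi v @[v --> -oo] --> (0 : R) -> exists B : R, forall x, `|phi x| <= B.
Proof.
move=> /cvgrPdist_lt /(_ _ ltr01) [X1 [_ h1]] /cvgrPdist_lt /(_ _ ltr01) [X2 [_ h2]].
pose X := `|X1| + `|X2| + 1.
have X0 : - X <= X by rewrite /X; have := normr_ge0 X1; have := normr_ge0 X2; lra.
have cn : continuous (fun x => `|phi x|).
  by move=> x; apply: continuous_comp; [exact: derivable_continuous | exact: norm_continuous].
have [c _ hc] := @EVT_max R _ _ _ X0 (continuous_subspaceT cn).
exists (Num.max 1 `|phi c|) => x; rewrite le_max.
have [xX|Xx] := ltP X1 x.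
  by have := h1 _ xX; rewrite sub0r normrN => /ltW ->.
have [xX'|Xx'] := ltP x X2.
  by have := h2 _ xX'; rewrite sub0r normrN => /ltW ->.
apply/orP; right; apply: hc; rewrite in_itv /= /X.
have := ler_norm X1; have := ler_norm (- X2); rewrite normrN.
by have := normr_ge0 X1; have := normr_ge0 X2; lra.
Qed.

(** Near s the quotient phi x / (x - s) is closer to phi'(s) than |phi'(s)|, hence of the same sign;
    multiplying by (x - s)^2 removes the denominator. *)
Lemma simple_zero_sign s : phi s = 0 -> derive1 phi s != 0 ->
  exists2 d : R, 0 < d & forall x, x != s -> `|x - s| < d ->
    0 < derive1 phi s * (phi x * (x - s)).
Proof.
move=> s0 ds; have nd : 0 < `|derive1 phi s| by rewrite normr_gt0.
have := @phi_diff s; rewrite /derivable => /cvg_ex [l hl].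
have lE : l = derive1 phi s by rewrite derive1E; apply/esym/cvg_lim.
move: hl; rewrite lE => /cvgrPdist_lt /(_ _ nd) /nbhs_ballP [d d0 hd].
exists d => // x xs xd.
have := hd (x - s); rewrite /ball /= sub0r normrN => /(_ xd).
rewrite subr_eq0 => /(_ xs); rewrite s0 subr0 /GRing.scale /= mulr1 subrK.
set a := derive1 phi s; set h := x - s; rewrite mulrC => ah.
have h0 : h != 0 by rewrite subr_eq0.
have h2 : 0 < h ^+ 2 by rewrite exprn_even_gt0.
have -> : a * (phi x * h) = a * (phi x / h) * h ^+ 2 by field.
rewrite mulr_gt0//; move: ah; set b := phi x / h.
have [a0|a0] := ltP 0 a.
  by rewrite (gtr0_norm a0) => ab; rewrite mulr_gt0//; have := ler_norm (a - b); lra.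
have a1 : a < 0 by rewrite lt_neqAle ds.
rewrite (ltr0_norm a1) => ab; rewrite nmulr_rgt0//.
by have := ler_norm (b - a); rewrite distrC; lra.
Qed.

End RealFunctions.

(** * The case k = 0: square roots of the first moment *)

Section ZeroWavenumber.
Context {R : realType}.

Lemma Delta0_root (phi : R -> R) (l : cplx R) : 0 < Re l -> Delta phi 0 l = 0 ->
  let a := \int[lebesgue_measure]_v (v * phi v) in
  0 < a /\ l = (Num.sqrt a)%:C.
Proof.
case: l => x y /= x0; rewrite /Delta eqxx; set a := Rintegral _ _ _ => h.
have l0 : (x +i* y : R[i]) != 0.
  by apply/eqP => /(congr1 Re) /= e; rewrite e ltxx in x0.
have : (x +i* y : R[i]) ^+ 2 = a%:C.
  have e : 1 = 1 / (x +i* y : R[i]) ^+ 2 * a%:C by apply/eqP; rewrite -subr_eq0; apply/eqP.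
  by rewrite -[LHS]mulr1 e mulrA mulrA mulr1 divff ?mul1r// expf_neq0.
rewrite expr2 => /[dup] /(congr1 Re) /= hr /(congr1 Im) /= hi.
have y0 : y = 0.
  have : x * y = 0 by lra.
  by move/eqP; rewrite mulf_eq0 gt_eqF//= => /eqP.
have ax : a = x ^+ 2 by rewrite -hr y0; ring.
by rewrite ax exprn_gt0// sqrtr_sqr gtr0_norm// y0.
Qed.

Lemma Delta0_sqrt (phi : R -> R) :
  let a := \int[lebesgue_measure]_v (v * phi v) in
  0 < a -> Delta phi 0 (Num.sqrt a)%:C = 0.
Proof.
move=> a a0; rewrite /Delta eqxx -/a.
have -> : ((Num.sqrt a)%:C : cplx R) ^+ 2 = (a%:C : R[i]).
  by rewrite -[LHS]/(((Num.sqrt a)%:C : R[i]) ^+ 2) -rmorphXn /= sqr_sqrtr// ltW.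
rewrite mul1r mulVf ?subrr//.
by rewrite -normc_eq0 normc_real normr_eq0 gt_eqF.
Qed.

End ZeroWavenumber.

Theorem theorem3 (R : realType) (phi : R -> R)
  (phi_diff : forall v : R, derivable phi v 1)
  (phi_L1 : (@lebesgue_measure R).-integrable setT (EFin \o phi))
  (phi_pinfty : phi v @[v --> +oo] --> (0 : R))
  (phi_ninfty : phi v @[v --> -oo] --> (0 : R))
  (dphi_bounded : exists M : R, forall v : R, `|derive1 phi v| <= M)
  (phi_nondeg : forall s : R, phi s = 0 -> derive1 phi s != 0) :
  (forall k : R, k != 0 ->
    (forall s : R, phi s = 0 -> boundary_value phi k s != 0) ->
    exists N Nplus Nminus : nat,
      [/\ count_with_multiplicity (Delta phi k)
            (Lambda phi k `&` @right_half_plane R) N,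
          [set s : R | [/\ phi s = 0, 0 < derive1 phi s
                         & boundary_value phi k s < 0]] #= `I_Nplus,
          [set s : R | [/\ phi s = 0, derive1 phi s < 0
                         & boundary_value phi k s < 0]] #= `I_Nminus
        & N%:Z = Nplus%:Z - Nminus%:Z])
  /\
  ((\int[@lebesgue_measure R]_v ((1 + `|v|) * `|phi v|)%:E < +oo)%E ->
    is_subset1 (Lambda phi 0 `&` @right_half_plane R) /\
    (Lambda phi 0 `&` @right_half_plane R !=set0 <->
       0 < \int[@lebesgue_measure R]_v (v * phi v))).
Proof.
split; last first.
  move=> _; split.
    move=> l m [[_ hl] l0] [[_ hm] m0].
    have [_ ->] := Delta0_root l0 hl; have [_ ->] := Delta0_root m0 hm.
    by [].
  split=> [[l [[_ hl] l0]]|a0]; first by have [] := Delta0_root l0 hl.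
  exists (Num.sqrt (\int[@lebesgue_measure R]_v (v * phi v)))%:C.
  split; last by rewrite /right_half_plane /= sqrtr_gt0.
  by split; [rewrite /= gt_eqF// sqrtr_gt0 | exact: Delta0_sqrt].
move=> k k0 bv0.
have [M hM] := dphi_bounded.
have cphi := derivable_continuous phi_diff.
have lip := bounded_derive_lipschitz phi_diff hM.
have [B hB] := bounded_of_limits phi_diff phi_pinfty phi_ninfty.
have [t ct Dt] := maximal_chain cphi phi_L1 k0 lip hB bv0.
have lift := has_lift_boundary_curve cphi phi_L1 k0 lip hB bv0 ct Dt.
have k20 : 0 < k ^+ 2 by rewrite exprn_even_gt0.
(* For k < 0 the lift of the conjugate curve is taken: it again turns counterclockwise in total, and
   the sine is a negative multiple of phi for either sign of k. *)
have [th [a [b [cth lim ab thE]]]] : exists (th : R -> R) (a b : int), [/\ continuous th,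
    limits_at_infinity th (2 * pi * a%:~R) (2 * pi * b%:~R), b - a = (size t)%:Z &
    forall x, exists2 r : R, 0 < r & r * cos (th x) = Re (boundary_curve phi k x) /\
      r * sin (th x) = - (pi * phi x / k ^+ 2)].
  case: (ltgtP k 0) (k0) => // kk _.
  - have [th [cth lim hth]] := has_lift_conj lift.
    exists th, (- (size t)%:Z), 0; split => //; last first.
    + move=> x; have [r r0 e] := hth x; exists r => //.
      have hc : Re (boundary_curve phi k x) = r * cos (th x) by rewrite -Re_conj e.
      have hs : - Im (boundary_curve phi k x) = r * sin (th x) by rewrite -Im_conj e.
      by rewrite -hc -hs Im_boundary_curve ltr0_sg//; split => //; ring.
    + by rewrite sub0r opprK.
    + move: lim; rewrite ltr0_sg//.
      have -> : - ((size t)%:R * (pi - -1 * pi)) = 2 * pi * (- (size t)%:Z)%:~R :> R.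
        by rewrite mulrNz -pmulrn; ring.
      have -> : - ((size t)%:R * (pi + -1 * pi)) = 2 * pi * 0%:~R :> R by ring.
      by [].
  - have [th [cth lim hth]] := lift.
    exists th, 0, (size t)%:Z; split => //; last first.
    + move=> x; have [r r0 e] := hth x; exists r => //.
      have hc : Re (boundary_curve phi k x) = r * cos (th x) by rewrite e.
      have hs : Im (boundary_curve phi k x) = r * sin (th x) by rewrite e.
      by rewrite -hc -hs Im_boundary_curve gtr0_sg// mul1r.
    + by rewrite subr0.
    + move: lim; rewrite gtr0_sg//.
      have -> : (size t)%:R * (pi - 1 * pi) = 2 * pi * 0%:~R :> R by ring.
      have -> : (size t)%:R * (pi + 1 * pi) = 2 * pi * ((size t)%:Z)%:~R :> R.
        by rewrite -pmulrn; ring.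
      by [].
pose P := [set s : R | [/\ phi s = 0, 0 < derive1 phi s & boundary_value phi k s < 0]].
pose N := [set s : R | [/\ phi s = 0, derive1 phi s < 0 & boundary_value phi k s < 0]].
have sinE x : exists2 c : R, 0 < c & sin (th x) = - (c * phi x).
  have [r r0 [_ hs]] := thE x; exists (pi / k ^+ 2 / r).
    by rewrite !divr_gt0// pi_gt0.
  have -> : sin (th x) = r * sin (th x) / r by rewrite mulrC mulKf// gt_eqF.
  by rewrite hs; ring.
(* The sine of the argument has the sign of -phi, so where phi increases through 0 the curve goes
   from the upper to the lower half-plane, counterclockwise on the negative axis. *)
have crossE s e : phi s = 0 -> boundary_value phi k s < 0 -> 0 < e * derive1 phi s ->
    crossing th e s.
  move=> s0 bs es; split.
    have [r r0 [hc _]] := thE s; have [c _ hs] := sinE s.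
    have sin0 : sin (th s) = 0 by rewrite hs s0 mulr0 oppr0.
    have : cos (th s) < 0 by rewrite -(pmulr_rlt0 _ r0) hc Re_boundary_curve.
    by have := sin0cos1 sin0 => /[swap] /ltr0_norm -> <-; rewrite opprK.
  have [d d0 hd] := simple_zero_sign phi_diff s0 (phi_nondeg s s0).
  exists d => // x.
  have sgn : x != s -> `|x - s| < d -> 0 < e * phi x * (x - s).
    move=> xs /(hd _ xs) h; have D2 : 0 < derive1 phi s ^+ 2.
      by rewrite exprn_even_gt0// phi_nondeg.
    rewrite -(pmulr_rgt0 _ D2).
    have := mulr_gt0 es h; congr (is_true (0 < _)); ring.
  have [c c0 ->] := sinE x.
  have -> : e * - (c * phi x) = - (c * (e * phi x)) by ring.
  split=> /andP[x1 x2].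
  - rewrite oppr_gt0 pmulr_rlt0// -(nmulr_lgt0 _ (_ : x - s < 0)) ?subr_lt0//.
    by apply: sgn; [rewrite lt_eqF | rewrite ltr_norml; lra].
  - rewrite oppr_lt0 pmulr_rgt0// -(pmulr_lgt0 _ (_ : 0 < x - s)) ?subr_gt0//.
    by apply: sgn; [rewrite gt_eqF | rewrite ltr_norml; lra].
have [p [n [Pp Nn pn]]] : exists p n : nat, [/\ P #= `I_p, N #= `I_n & p%:Z - n%:Z = b - a].
  apply: (crossing_count cth lim).
  - move=> s cs; have [r r0 [hc _]] := thE s; have [c c0 hs] := sinE s.
    have sin0 : sin (th s) = 0 by apply: cos1sin0; rewrite cs normrN normr1.
    have s0 : phi s = 0.
      by move/eqP: hs; rewrite sin0 eq_sym oppr_eq0 mulf_eq0 gt_eqF//= => /eqP.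
    have bs : boundary_value phi k s < 0.
      by rewrite -Re_boundary_curve// -hc cs mulrN1 oppr_lt0.
    by case: (ltgtP (derive1 phi s) 0) (phi_nondeg s s0) => // ds _; [right|left].
  - by move=> s [s0 ds bs]; apply: crossE => //; rewrite mul1r.
  - by move=> s [s0 ds bs]; apply: crossE => //; rewrite mulN1r oppr_gt0.
exists (size t), p, n; split => //; first exact: (zero_count cphi phi_L1 k0 ct Dt).
by rewrite pn ab.
Qed.
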